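(* Let $p\in\mathbb{N}$, $p\ge1$. Let $$\Phi(z)=\sum_{k=1}^p|z|^{2(k-1)}F_{p-k+1}(z)$$ be a $p$-harmonic function in $\mathbb{D}=\{z\in\mathbb{C}:|z|<1\}$ with $\Phi(0)=0$, where $F_{p-k+1}=h_{p-k+1}+\overline{g_{p-k+1}}$ $(k=1,\dots,p)$ are harmonic functions in $\mathbb{D}$ and $h_{p-k+1}$, $g_{p-k+1}$ are analytic in $\mathbb{D}$. Suppose $J_\Phi(z)>0$ in $\mathbb{D}$. Then $\Phi$ is fully starlike if and only if $$\sum_{k=1}^p|z|^{2(k-1)}\,\mathrm{Re}\left\{z\,h'_{p-k+1}(z)\overline{\Phi(z)}\right\}\ \ge\ \sum_{k=1}^p|z|^{2(k-1)}\,\mathrm{Re}\left\{z\,g'_{p-k+1}(z)\Phi(z)\right\},\qquad z\in\mathbb{D}.$$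
   Context: A complex-valued function $\Phi\in C^{2p}(\mathbb{D})$ is $p$-harmonic in $\mathbb{D}$ if $\Delta^p\Phi=0$ there, where $\Delta=4\frac{\partial^2}{\partial z\,\partial\overline z}$; equivalently it has a representation $\Phi(z)=\sum_{k=1}^p|z|^{2(k-1)}F_{p-k+1}(z)$ with harmonic $F_{p-k+1}$. The Jacobian is $J_\Phi=|\Phi_z|^2-|\Phi_{\overline z}|^2$. The function $\Phi$ with $\Phi(0)=0$ is fully starlike if $\Phi(r\mathbb{D})$, where $r\mathbb{D}=\{|z|<r\}$, is a domain starlike with respect to the origin for every $r\in(0,1)$. *)

(* Defs.v *)
(* Stdlib reals with Coquelicot; the complex plane is Coquelicot's C = R * R. *)
From Stdlib Require Import Reals.
From Coquelicot Require Import Coquelicot.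
Open Scope C_scope.

Definition disk (r : R) (z : C) : Prop := (Cmod z < r)%R.

Definition partial_x (f : C -> C) (z : C) : C :=
  (Derive (fun t => Re (f (t, Im z))) (Re z),
   Derive (fun t => Im (f (t, Im z))) (Re z)).

Definition partial_y (f : C -> C) (z : C) : C :=
  (Derive (fun t => Re (f (Re z, t))) (Im z),
   Derive (fun t => Im (f (Re z, t))) (Im z)).

Definition d_z (f : C -> C) (z : C) : C :=
  (partial_x f z - Ci * partial_y f z) / 2.

Definition d_zbar (f : C -> C) (z : C) : C :=
  (partial_x f z + Ci * partial_y f z) / 2.

Definition laplacian (f : C -> C) (z : C) : C := 4 * d_z (d_zbar f) z.

(* [ex_diff_n u n x y] : the iterated partial derivatives of u of order <= n
   exist and are continuous at (x, y). *)
Definition C_n_on_disk (n : nat) (f : C -> C) : Prop :=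
  forall z : C, disk 1 z ->
    ex_diff_n (fun x y => Re (f (x, y))) n (Re z) (Im z) /\
    ex_diff_n (fun x y => Im (f (x, y))) n (Re z) (Im z).

Definition p_harmonic (p : nat) (f : C -> C) : Prop :=
  C_n_on_disk (2 * p) f /\
  forall z : C, disk 1 z -> Nat.iter p laplacian f z = 0.

Definition harmonic (f : C -> C) : Prop := p_harmonic 1 f.

Definition analytic (f : C -> C) : Prop :=
  forall z : C, disk 1 z -> ex_derive (K := C_AbsRing) (V := C_NormedModule) f z.

Definition jacobian (f : C -> C) (z : C) : R :=
  (Cmod (d_z f z) ^ 2 - Cmod (d_zbar f z) ^ 2)%R.

Definition image (f : C -> C) (A : C -> Prop) (w : C) : Prop :=
  exists z : C, A z /\ f z = w.

Definition connected (A : C -> Prop) : Prop :=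
  forall U V : C -> Prop, open U -> open V ->
    (forall z, A z -> U z \/ V z) ->
    (exists z, A z /\ U z) -> (exists z, A z /\ V z) ->
    exists z, A z /\ U z /\ V z.

Definition domain (A : C -> Prop) : Prop :=
  (exists z, A z) /\ open A /\ connected A.

Definition starlike_wrt_origin (A : C -> Prop) : Prop :=
  A 0 /\
  forall (w : C) (t : R), A w -> (0 <= t <= 1)%R -> A (RtoC t * w).

(* Univalence of f is not part of the notion: the condition is on image sets. *)
Definition fully_starlike (f : C -> C) : Prop :=
  f 0 = 0 /\
  forall r : R, (0 < r < 1)%R ->
    domain (image f (disk r)) /\ starlike_wrt_origin (image f (disk r)).

(* Main.v *)
(* Put [Q z = |Phi|^2 d(arg Phi)/d(theta)], the angular derivative along the circle
   through [z]; the two sums of the theorem differ by [Q z].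

   Lifting the segment from [Phi z] to [0] through the local diffeomorphism [Phi],
   the modulus [|z|] changes at a rate of sign opposite to that of [Q].  If [Q >= 0]
   everywhere, lifts never leave the disk they start in, so all images are starlike.

   Conversely, let the images be starlike and let [rad] be the largest radius such
   that [Q >= 0] on [|z| < rad].  Lifts stay in the closed disk of radius [rad], where
   [0] is the only zero of [Phi]; following two lifts down to [0] shows that [Phi] is
   injective on this closed disk, hence, by compactness and local injectivity, on a
   slightly larger one.  There starlikeness forces [Q >= 0]: a point with [Q < 0] would
   have a lift leaving the disk through it, while starlikeness provides a second
   preimage inside.  So [rad = 1].

   Differential equations are avoided: lifts are built from first-order steps, with
   a little slack in the modulus that is removed by compactness. *)
Require Import Defs.
From Stdlib Require Import Reals Lra Lia Classical.
From Coquelicot Require Import Coquelicot.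
Open Scope R_scope.

(** * Continuous induction and cluster points *)

(** The supremum of the good parameters is good by the closure hypothesis, and the step hypothesis
    then forces it to be [b]. [P] may fail at parameters in between. This replaces the continuation
    of solutions of a differential equation in all lifting arguments below. *)
Lemma real_induction (b : R) (P : R -> Prop) :
  0 <= b -> P 0 ->
  (forall s, 0 <= s < b -> P s -> exists s', s < s' <= b /\ P s') ->
  (forall s, 0 < s <= b ->
     (forall eta, 0 < eta -> exists s', s - eta < s' <= s /\ 0 <= s' /\ P s') -> P s) ->
  P b.
Proof.
  intros Hb H0 Hstep Hclosed.
  destruct (completeness (fun s => 0 <= s <= b /\ P s)) as [m [Hub Hlub]].
  { exists b; intros s [Hs _]; lra. }
  { exists 0; split; [lra | exact H0]. }
  assert (m0 : 0 <= m) by (apply Hub; split; [lra | exact H0]).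
  assert (mb : m <= b) by (apply Hlub; intros s [Hs _]; lra).
  assert (Pm : P m).
  { destruct (Req_dec m 0) as [-> | mn0]; [exact H0 |].
    apply Hclosed; [lra |]. intros eta Heta.
    apply NNPP; intros Hn.
    assert (m <= m - eta); [| lra].
    apply Hlub; intros s [Hs Ps].
    destruct (Rle_lt_dec s (m - eta)) as [H | H]; [exact H |].
    exfalso; apply Hn; exists s; repeat split; try tauto; try lra.
    apply Hub; split; assumption. }
  destruct (Req_dec m b) as [<- | mnb]; [exact Pm |].
  destruct (Hstep m) as [s' [Hs' Ps']]; [lra | exact Pm |].
  assert (s' <= m); [| lra].
  apply Hub; split; [lra | exact Ps'].
Qed.

(** Bolzano-Weierstrass without sequences: [P e x] reads as [x] being admissible with tolerance [e],
    and [a] is the upper limit of [phi] as the tolerance shrinks, that is, the supremum of the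
    levels reached at every tolerance. *)
Lemma cluster_R {X : Type} (P : R -> X -> Prop) (phi : X -> R) (M : R)
  (mono : forall e e' x, e <= e' -> P e x -> P e' x)
  (ex : forall e, 0 < e -> exists x, P e x)
  (bounded : forall e x, P e x -> Rabs (phi x) <= M) :
  exists a, forall e, 0 < e -> exists x, P e x /\ Rabs (phi x - a) < e.
Proof.
  destruct (completeness
    (fun y => forall e, 0 < e -> exists x, P e x /\ y <= phi x)) as [a [Hub Hlub]].
  { exists M; intros y Hy. destruct (Hy 1) as [x [Px Hx]]; [lra |].
    apply bounded in Px. apply Rabs_le_between in Px. lra. }
  { exists (- M); intros e He. destruct (ex e He) as [x Px].
    exists x; split; [exact Px |].
    apply bounded in Px. apply Rabs_le_between in Px. lra. }
  exists a; intros e He.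
  assert (Hhigh : exists e0, 0 < e0 /\ forall x, P e0 x -> phi x < a + e).
  { apply NNPP; intros Hn.
    assert (a + e <= a); [| lra].
    apply Hub; intros e0 He0. apply NNPP; intros Hn'.
    apply Hn; exists e0; split; [exact He0 |]. intros x Px.
    destruct (Rlt_le_dec (phi x) (a + e)) as [H | H]; [exact H |].
    exfalso; apply Hn'; exists x; split; assumption. }
  destruct Hhigh as [e0 [He0 Hhigh]].
  assert (Hlow : exists x, P (Rmin e e0) x /\ a - e < phi x).
  { apply NNPP; intros Hn.
    assert (a <= a - e); [| lra].
    apply Hlub; intros y Hy.
    destruct (Hy (Rmin e e0)) as [x [Px Hx]]; [apply Rmin_pos; assumption |].
    destruct (Rle_lt_dec y (a - e)) as [H | H]; [exact H |].
    exfalso; apply Hn; exists x; split; [exact Px | lra]. }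
  destruct Hlow as [x [Px Hx]].
  exists x; split; [exact (mono _ _ _ (Rmin_l e e0) Px) |].
  apply (mono _ _ _ (Rmin_r e e0)), Hhigh in Px.
  apply Rabs_def1; lra.
Qed.

Lemma im_le_Cmod (z : C) : Rabs (Im z) <= Cmod z.
Proof. exact (Rle_trans _ _ _ (Rmax_r _ _) (Rmax_Cmod z)). Qed.

Lemma Cmod_le_Re_Im (z : C) : Cmod z <= Rabs (Re z) + Rabs (Im z).
Proof.
  destruct z as [x y].
  replace ((x, y) : C) with (RtoC x + Ci * RtoC y)%C
    by (apply injective_projections; simpl; ring).
  eapply Rle_trans; [apply Cmod_triangle |].
  rewrite Cmod_mult, Cmod_Ci, !Cmod_R. simpl.
  apply Req_le. rewrite Rmult_1_l. f_equal; f_equal; ring.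
Qed.

(** The real parts cluster first; the imaginary parts are then treated for the predicate that also
    keeps the real part close to its cluster value. *)
Lemma cluster_C {X : Type} (P : R -> X -> Prop) (phi : X -> C) (M : R)
  (mono : forall e e' x, e <= e' -> P e x -> P e' x)
  (ex : forall e, 0 < e -> exists x, P e x)
  (bounded : forall e x, P e x -> Cmod (phi x) <= M) :
  exists a, forall e, 0 < e -> exists x, P e x /\ Cmod (phi x - a) < e.
Proof.
  destruct (cluster_R P (fun x => Re (phi x)) M mono ex) as [a Ha].
  { intros e x Px. exact (Rle_trans _ _ _ (re_le_Cmod _) (bounded e x Px)). }
  destruct (cluster_R (fun e x => P e x /\ Rabs (Re (phi x) - a) < e)
              (fun x => Im (phi x)) M) as [b Hb].
  { intros e e' x He [Px Hx]; split; [exact (mono e e' x He Px) | lra]. }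
  { exact Ha. }
  { intros e x [Px _]. exact (Rle_trans _ _ _ (im_le_Cmod _) (bounded e x Px)). }
  exists (a, b); intros e He.
  destruct (Hb (e / 2)) as [x [[Px Hx] Hy]]; [lra |].
  exists x; split; [apply (mono (e / 2)); [lra | exact Px] |].
  eapply Rle_lt_trans; [apply Cmod_le_Re_Im |].
  destruct (phi x) as [u v]; simpl in *. unfold Rminus in *. lra.
Qed.

(** * Modulus inequalities, real-linear maps and strict differentiability *)

Lemma Cmod_minus_diag (z : C) : Cmod (z - z) = 0.
Proof. replace (z - z)%C with (RtoC 0) by ring. apply Cmod_0. Qed.

Lemma Cmod_minus_sym (z w : C) : Cmod (z - w) = Cmod (w - z).
Proof. rewrite <- Cmod_opp. f_equal. ring. Qed.

Lemma Cmod_minus_triangle (a b c : C) : Cmod (a - c) <= Cmod (a - b) + Cmod (b - c).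
Proof. replace (a - c)%C with ((a - b) + (b - c))%C by ring. apply Cmod_triangle. Qed.

Lemma Cmod_le_minus (a b : C) : Cmod a <= Cmod (a - b) + Cmod b.
Proof. replace a with ((a - b) + b)%C at 1 by ring. apply Cmod_triangle. Qed.

Lemma Cmod_minus_eq_0 (a b : C) : Cmod (a - b) <= 0 -> a = b.
Proof.
  intros H.
  assert (E : (a - b)%C = 0%C)
    by (apply Cmod_eq_0, Rle_antisym; [exact H | apply Cmod_ge_0]).
  transitivity ((a - b) + b)%C; [ring | rewrite E; ring].
Qed.

(** The real-linear map with columns [a] and [b]; for the two partial derivatives of a function it
    is the real differential. *)
Definition linear_map (a b xi : C) : C := (RtoC (Re xi) * a + RtoC (Im xi) * b)%C.

(** The determinant of the columns [a] and [b], equal to the imaginary part of [Cconj a * b]. *)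
Definition cross (a b : C) : R := Re a * Im b - Im a * Re b.

(** Both points vary near [z], so the differential at the single point [z] controls all increments
    nearby, from above and, when it is invertible, from below. *)
Definition strictly_differentiable (f : C -> C) (z : C) : Prop :=
  forall e, 0 < e -> exists rho, 0 < rho /\
    forall u v, Cmod (u - z) < rho -> Cmod (v - z) < rho ->
      Cmod (f v - f u - linear_map (partial_x f z) (partial_y f z) (v - u))
        <= e * Cmod (v - u).

(** All of the geometric argument is carried out for these orientation-preserving local
    diffeomorphisms; [cross] of the partial derivatives is the Jacobian. *)
Definition regular (f : C -> C) : Prop :=
  forall z, Cmod z < 1 ->
    strictly_differentiable f z /\ 0 < cross (partial_x f z) (partial_y f z).

(* With [z = r e^(i theta)], this is [|f|^2] times the derivative of [arg f]
   with respect to [theta]. *)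
Definition rotation (f : C -> C) (z : C) : R :=
  cross (f z) (linear_map (partial_x f z) (partial_y f z) (Ci * z)).

Lemma linear_map_minus a b u v :
  linear_map a b (u - v) = (linear_map a b u - linear_map a b v)%C.
Proof. apply injective_projections; simpl; unfold Re, Im; simpl; ring. Qed.

Lemma linear_map_scal a b (t : R) u :
  linear_map a b (RtoC t * u) = (RtoC t * linear_map a b u)%C.
Proof. apply injective_projections; simpl; unfold Re, Im; simpl; ring. Qed.

Lemma linear_map_bound a b u :
  Cmod (linear_map a b u) <= (Cmod a + Cmod b) * Cmod u.
Proof.
  unfold linear_map. eapply Rle_trans; [apply Cmod_triangle |].
  rewrite !Cmod_mult, !Cmod_R.
  pose proof (re_le_Cmod u). pose proof (im_le_Cmod u).
  pose proof (Cmod_ge_0 a). pose proof (Cmod_ge_0 b). nra.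
Qed.

Lemma cross_bound a b : Rabs (cross a b) <= 2 * Cmod a * Cmod b.
Proof.
  unfold cross. eapply Rle_trans; [apply Rabs_triang |].
  rewrite Rabs_Ropp, !Rabs_mult.
  pose proof (re_le_Cmod a). pose proof (im_le_Cmod a).
  pose proof (re_le_Cmod b). pose proof (im_le_Cmod b).
  assert (Rabs (Re a) * Rabs (Im b) <= Cmod a * Cmod b)
    by (apply Rmult_le_compat; auto using Rabs_pos).
  assert (Rabs (Im a) * Rabs (Re b) <= Cmod a * Cmod b)
    by (apply Rmult_le_compat; auto using Rabs_pos).
  lra.
Qed.

(** Cramer's rule. *)
Definition linear_inverse (a b w : C) : C :=
  (cross w b / cross a b, cross a w / cross a b).

Lemma linear_inverse_r a b w : cross a b <> 0 ->
  linear_map a b (linear_inverse a b w) = w.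
Proof.
  intros H. apply injective_projections;
    unfold linear_inverse, linear_map, cross, Re, Im in *; simpl; field; exact H.
Qed.

Lemma linear_inverse_l a b u : cross a b <> 0 ->
  linear_inverse a b (linear_map a b u) = u.
Proof.
  intros H. apply injective_projections;
    unfold linear_inverse, linear_map, cross, Re, Im in *; simpl; field; exact H.
Qed.

Lemma linear_inverse_bound a b : 0 < cross a b ->
  exists K, 0 < K /\ forall w, Cmod (linear_inverse a b w) <= K * Cmod w.
Proof.
  intros H. exists (2 * (Cmod a + Cmod b + 1) / cross a b). split.
  { apply Rdiv_lt_0_compat; [| exact H].
    pose proof (Cmod_ge_0 a). pose proof (Cmod_ge_0 b). lra. }
  intros w. eapply Rle_trans; [apply Cmod_le_Re_Im |]. simpl.
  unfold Rdiv. rewrite !Rabs_mult, Rabs_inv, (Rabs_pos_eq (cross a b)) by lra.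
  pose proof (cross_bound w b). pose proof (cross_bound a w).
  pose proof (Rinv_0_lt_compat _ H). pose proof (Cmod_ge_0 w).
  rewrite <- Rmult_plus_distr_r.
  apply Rle_trans with (2 * (Cmod a + Cmod b + 1) * Cmod w * / cross a b); [| lra].
  apply Rmult_le_compat_r; [lra |]. nra.
Qed.

Lemma strictly_differentiable_continuous f z : strictly_differentiable f z ->
  exists rho L, 0 < rho /\ 0 < L /\
    forall u v, Cmod (u - z) < rho -> Cmod (v - z) < rho ->
      Cmod (f v - f u) <= L * Cmod (v - u).
Proof.
  intros H. destruct (H 1) as [rho [Hrho Hf]]; [lra |].
  exists rho, (Cmod (partial_x f z) + Cmod (partial_y f z) + 1).
  pose proof (Cmod_ge_0 (partial_x f z)). pose proof (Cmod_ge_0 (partial_y f z)).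
  repeat split; [exact Hrho | lra |].
  intros u v Hu Hv. specialize (Hf u v Hu Hv).
  pose proof (linear_map_bound (partial_x f z) (partial_y f z) (v - u)).
  pose proof (Cmod_le_minus (f v - f u)
    (linear_map (partial_x f z) (partial_y f z) (v - u))).
  lra.
Qed.

(** Near [a] the function is Lipschitz with some constant [L], so [Cmod (f a - y)] is at most
    [(L + Rabs M) * e] for every small [e]. This passes the equations satisfied by approximate lifts
    to their cluster points. *)
Lemma regular_limit f a y M : regular f -> Cmod a < 1 ->
  (forall e, 0 < e -> exists z, Cmod (z - a) < e /\ Cmod (f z - y) <= M * e) -> f a = y.
Proof.
  intros Hf Ha H. apply Cmod_minus_eq_0.
  destruct (strictly_differentiable_continuous f a (proj1 (Hf a Ha)))
    as [rho [L [Hrho [HL Hc]]]].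
  apply Rnot_lt_le; intros Hd.
  set (d := Cmod (f a - y)) in *.
  assert (HM : 0 < L + Rabs M + 1) by (pose proof (Rabs_pos M); lra).
  set (e := Rmin rho (d / (L + Rabs M + 1))).
  assert (He : 0 < e) by (apply Rmin_pos; [exact Hrho | apply Rdiv_lt_0_compat; lra]).
  destruct (H e He) as [z [Hz Hy]].
  assert (Hza : Cmod (f a - f z) <= L * Cmod (a - z)).
  { apply Hc; [apply Rlt_le_trans with e; [exact Hz | apply Rmin_l] |].
    rewrite Cmod_minus_diag. exact Hrho. }
  rewrite (Cmod_minus_sym a z) in Hza.
  pose proof (Cmod_minus_triangle (f a) (f z) y) as Ht. fold d in Ht.
  assert (Hed : e * (L + Rabs M + 1) <= d).
  { apply Rle_trans with (d / (L + Rabs M + 1) * (L + Rabs M + 1)).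
    - apply Rmult_le_compat_r; [lra | apply Rmin_r].
    - apply Req_le. field. lra. }
  pose proof (Rle_abs M). nra.
Qed.

Lemma Cmod_limit_le a b s :
  (forall e, 0 < e -> exists x, Cmod (x - a) < e /\ Cmod (x - b) <= s) ->
  Cmod (a - b) <= s.
Proof.
  intros H. apply le_epsilon; intros e He.
  destruct (H e He) as [x [Hx Hs]].
  pose proof (Cmod_minus_triangle a x b). rewrite Cmod_minus_sym in Hx. lra.
Qed.

(** * Local inversion of regular maps *)

(** A cluster point of near-minimisers is a minimiser: it stays in the closed disk, and the
    Lipschitz bound, valid there because that disk lies inside the one about [u], carries the values
    to the limit. *)
Lemma distance_minimizer f z0 s y u rho L :
  0 <= s ->
  (forall z z', Cmod (z - u) < rho -> Cmod (z' - u) < rho ->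
     Cmod (f z' - f z) <= L * Cmod (z' - z)) ->
  Cmod (z0 - u) + s < rho ->
  exists a, Cmod (a - z0) <= s /\
    forall z, Cmod (z - z0) <= s -> Cmod (f a - y) <= Cmod (f z - y).
Proof.
  intros Hs HL Hball.
  assert (Hin : forall z, Cmod (z - z0) <= s -> Cmod (z - u) < rho).
  { intros z Hz. pose proof (Cmod_minus_triangle z z0 u). lra. }
  assert (Hz0 : Cmod (z0 - z0) <= s).
  { rewrite Cmod_minus_diag. exact Hs. }
  destruct (completeness
    (fun x => forall z, Cmod (z - z0) <= s -> x <= Cmod (f z - y))) as [m [Hub Hlub]].
  { exists (Cmod (f z0 - y)). intros x Hx. apply Hx, Hz0. }
  { exists 0. intros z _. apply Cmod_ge_0. }
  destruct (cluster_C (fun e z => Cmod (z - z0) <= s /\ Cmod (f z - y) <= m + e)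
              (fun z => z) (s + Cmod z0)) as [a Ha].
  { intros e e' z He [H1 H2]; split; [exact H1 | lra]. }
  { intros e He. apply NNPP; intros Hn.
    assert (m + e <= m); [| lra].
    apply Hub; intros z Hz. apply Rnot_lt_le; intros H.
    apply Hn; exists z; split; [exact Hz | lra]. }
  { intros e z [Hz _]. pose proof (Cmod_le_minus z z0). lra. }
  assert (Haz : Cmod (a - z0) <= s).
  { apply Cmod_limit_le. intros e He. destruct (Ha e He) as [z [[H1 _] H2]].
    exists z; split; assumption. }
  exists a; split; [exact Haz |]. intros z Hz.
  apply Rle_trans with m; [| apply Hlub; intros x Hx; exact (Hx z Hz)].
  apply le_epsilon; intros e He.
  assert (HL' : 0 < Rabs L + 1) by (pose proof (Rabs_pos L); lra).
  destruct (Ha (e / (Rabs L + 2))) as [x [[H1 H2] H3]].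
  { apply Rdiv_lt_0_compat; lra. }
  specialize (HL x a (Hin x H1) (Hin a Haz)).
  pose proof (Cmod_minus_triangle (f a) (f x) y).
  rewrite (Cmod_minus_sym a x) in HL.
  pose proof (Cmod_ge_0 (x - a)). pose proof (Rle_abs L).
  assert (e = (Rabs L + 2) * (e / (Rabs L + 2))) by (field; lra).
  set (d := e / (Rabs L + 2)) in *. nra.
Qed.

(* Surjectivity comes from minimising the distance to the target over a small
   closed disk: at an interior minimiser with nonzero residual a step in the
   direction given by the inverse differential would reduce it. *)
Lemma local_homeo f u : regular f -> Cmod u < 1 ->
  exists rho c, 0 < rho /\ 0 < c /\ Cmod u + rho <= 1 /\
    (forall z z', Cmod (z - u) < rho -> Cmod (z' - u) < rho ->
       c * Cmod (z' - z) <= Cmod (f z' - f z)) /\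
    (forall z y, 2 * Cmod (y - f z) < c * (rho - Cmod (z - u)) ->
       exists z', Cmod (z' - u) < rho /\ f z' = y).
Proof.
  intros Hf Hu. destruct (Hf u Hu) as [Hd HJ].
  set (a := partial_x f u) in *; set (b := partial_y f u) in *.
  destruct (linear_inverse_bound a b HJ) as [K [HK Hinv]].
  assert (Hc : 0 < / (2 * K)) by (apply Rinv_0_lt_compat; lra).
  assert (HcK : / (2 * K) * K = / 2) by (field; lra).
  (* The differential expands lengths by at least [/ K]; a linearisation error of half that rate
     leaves the expansion constant [c = / (2 * K)] for [f]. *)
  destruct (Hd (/ (2 * K)) Hc) as [rho1 [Hrho1 Hd1]].
  fold a b in Hd1.
  destruct (strictly_differentiable_continuous f u Hd) as [rho2 [L [Hrho2 [_ HL]]]].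
  set (rho := Rmin (Rmin rho1 rho2) (1 - Cmod u)).
  assert (Hr1 : rho <= rho1) by (eapply Rle_trans; apply Rmin_l).
  assert (Hr2 : rho <= rho2)
    by (eapply Rle_trans; [apply Rmin_l | apply Rmin_r]).
  assert (Hr3 : rho <= 1 - Cmod u) by apply Rmin_r.
  assert (Hr : 0 < rho) by (repeat apply Rmin_pos; lra).
  set (c := / (2 * K)) in *.
  assert (Hlow : forall z z', Cmod (z - u) < rho -> Cmod (z' - u) < rho ->
       c * Cmod (z' - z) <= Cmod (f z' - f z)).
  { intros z z' Hz Hz'.
    specialize (Hd1 z z' ltac:(lra) ltac:(lra)).
    pose proof (Hinv (linear_map a b (z' - z))) as Hi.
    rewrite linear_inverse_l in Hi by lra.
    pose proof (Cmod_le_minus (linear_map a b (z' - z)) (f z' - f z)) as Ht.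
    rewrite (Cmod_minus_sym (linear_map a b (z' - z))) in Ht.
    assert (2 * c * Cmod (z' - z) <= Cmod (linear_map a b (z' - z))); [| lra].
    apply Rmult_le_reg_l with K; [exact HK |].
    replace (K * (2 * c * Cmod (z' - z))) with (2 * (c * K) * Cmod (z' - z)) by ring.
    rewrite HcK. lra. }
  exists rho, c. repeat split; [exact Hr | exact Hc | lra | exact Hlow |].
  intros z0 y Hy.
  (* The midpoint of two bounds: [s] is large enough for the minimiser to be interior and small
     enough for the closed disk to stay within [rho] of [u]. *)
  set (s := (2 * Cmod (y - f z0) / c + (rho - Cmod (z0 - u))) / 2).
  assert (Hdiv : 2 * Cmod (y - f z0) / c < rho - Cmod (z0 - u)).
  { apply Rmult_lt_reg_r with c; [exact Hc |].
    unfold Rdiv. rewrite Rmult_assoc, Rinv_l by lra. lra. }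
  assert (Hs1 : 2 * Cmod (y - f z0) < c * s).
  { replace (2 * Cmod (y - f z0)) with (c * (2 * Cmod (y - f z0) / c)) by (field; lra).
    apply Rmult_lt_compat_l; [exact Hc | unfold s; lra]. }
  assert (Hs2 : Cmod (z0 - u) + s < rho) by (unfold s; lra).
  pose proof (Cmod_ge_0 (y - f z0)).
  assert (Hs0 : 0 < s)
    by (apply Rmult_lt_reg_l with c; [exact Hc | rewrite Rmult_0_r; lra]).
  destruct (distance_minimizer f z0 s y u rho L) as [m [Hm1 Hm2]]; [lra | | lra |].
  { intros z z' Hz Hz'. apply HL; lra. }
  assert (Hmu : Cmod (m - u) < rho) by (pose proof (Cmod_minus_triangle m z0 u); lra).
  exists m; split; [exact Hmu |].
  destruct (Ceq_dec (f m) y) as [E | E]; [exact E | exfalso].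
  assert (Hz0 : Cmod (z0 - z0) <= s).
  { rewrite Cmod_minus_diag. lra. }
  assert (Hz0u : Cmod (z0 - u) < rho) by lra.
  (* The minimiser is at least as good as the centre [z0], so [f m] is within [2 * Cmod (y - f z0)]
     of [f z0]; the expansion bound then places [m] strictly inside. *)
  assert (Hint : Cmod (m - z0) < s).
  { pose proof (Hlow z0 m Hz0u Hmu) as Hl.
    pose proof (Hm2 z0 Hz0) as Hmin. rewrite (Cmod_minus_sym (f z0) y) in Hmin.
    pose proof (Cmod_minus_triangle (f m) y (f z0)).
    apply Rmult_lt_reg_l with c; [exact Hc | lra]. }
  set (w := (y - f m)%C).
  assert (Hw : 0 < Cmod w).
  { apply Cmod_gt_0. intros H0. apply E. symmetry.
    transitivity (w + f m)%C; [unfold w; ring | rewrite H0; ring]. }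
  set (xi := linear_inverse a b w).
  assert (Hxi : Cmod xi <= K * Cmod w) by apply Hinv.
  (* The step length keeps [m + tau * xi] in the closed disk. *)
  set (tau := Rmin 1 ((s - Cmod (m - z0)) / (K * Cmod w + 1))).
  assert (HKw : 0 < K * Cmod w) by (apply Rmult_lt_0_compat; assumption).
  assert (Htau : 0 < tau) by (apply Rmin_pos; [lra | apply Rdiv_lt_0_compat; lra]).
  assert (Htau1 : tau <= 1) by apply Rmin_l.
  assert (Htau2 : tau * (K * Cmod w + 1) <= s - Cmod (m - z0)).
  { apply Rle_trans with
      ((s - Cmod (m - z0)) / (K * Cmod w + 1) * (K * Cmod w + 1)).
    - apply Rmult_le_compat_r; [lra | apply Rmin_r].
    - apply Req_le. field. lra. }
  set (z := (m + RtoC tau * xi)%C).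
  assert (Hzm : Cmod (z - m) <= tau * (K * Cmod w)).
  { replace (z - m)%C with (RtoC tau * xi)%C by (unfold z; ring).
    rewrite Cmod_mult, Cmod_R, Rabs_pos_eq by lra.
    apply Rmult_le_compat_l; lra. }
  assert (Hzz0 : Cmod (z - z0) <= s)
    by (pose proof (Cmod_minus_triangle z m z0); lra).
  assert (Hzu : Cmod (z - u) < rho) by (pose proof (Cmod_minus_triangle z z0 u); lra).
  pose proof (Hm2 z Hzz0) as Hmin.
  specialize (Hd1 m z ltac:(lra) ltac:(lra)).
  assert (Hlin : linear_map a b (z - m) = (RtoC tau * w)%C).
  { replace (z - m)%C with (RtoC tau * xi)%C by (unfold z; ring).
    rewrite linear_map_scal. unfold xi. rewrite linear_inverse_r by lra. reflexivity. }
  rewrite Hlin in Hd1.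
  assert (Hdec : Cmod (f z - y) <= Cmod (f z - f m - RtoC tau * w) + (1 - tau) * Cmod w).
  { replace (f z - y)%C with ((f z - f m - RtoC tau * w) + RtoC (1 - tau) * (- w))%C.
    - eapply Rle_trans; [apply Cmod_triangle |].
      rewrite Cmod_mult, Cmod_R, Cmod_opp, Rabs_pos_eq by lra. lra.
    - unfold w. rewrite RtoC_minus. ring. }
  assert (Hmw : Cmod (f m - y) = Cmod w) by (unfold w; apply Cmod_minus_sym).
  (* The linearisation error eats at most half of the gain [tau * Cmod w], so the residual drops to
     at most [(1 - tau / 2) * Cmod w], contradicting minimality. *)
  assert (c * Cmod (z - m) <= tau * Cmod w / 2); [| nra].
  apply Rle_trans with (c * (tau * (K * Cmod w))).
  - apply Rmult_le_compat_l; lra.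
  - apply Req_le. replace (c * (tau * (K * Cmod w))) with ((c * K) * (tau * Cmod w)) by ring.
    rewrite HcK. field.
Qed.

(** * First-order lifting of radial segments *)

(** The inner product of [z] and [v] is [cross v (Ci * z)], and a linear map multiplies [cross] by
    its determinant; here [v] is the preimage of [- w]. *)
Lemma linear_inverse_inner a b z w : cross a b <> 0 ->
  Re z * Re (linear_inverse a b (- w)) + Im z * Im (linear_inverse a b (- w)) =
  - (cross w (linear_map a b (Ci * z)) / cross a b).
Proof.
  intros H. unfold linear_inverse, linear_map, cross, Re, Im in *. simpl.
  field. exact H.
Qed.

(* First-order lift of the radial segment from [f z] towards the origin: the
   velocity is [- A^{-1} (f z)], whose inner product with [z] is
   [- rotation f z / J]. *)
Lemma radial_step f z : regular f -> Cmod z < 1 ->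
  forall e, 0 < e -> exists d0, 0 < d0 /\
    forall d, 0 < d < d0 -> exists z',
      f z' = (RtoC (1 - d) * f z)%C /\ Cmod (z' - z) < e /\
      Rabs (Cmod z' ^ 2 - Cmod z ^ 2 +
            2 * d * (rotation f z / cross (partial_x f z) (partial_y f z))) <= e * d.
Proof.
  intros Hf Hz e He.
  destruct (local_homeo f z Hf Hz) as [rho [c [Hrho [Hc [_ [Hlow Hsur]]]]]].
  destruct (Hf z Hz) as [Hd HJ].
  set (a := partial_x f z) in *; set (b := partial_y f z) in *.
  destruct (linear_inverse_bound a b HJ) as [K [HK Hinv]].
  set (W := Cmod (f z) + 1).
  pose proof (Cmod_ge_0 (f z)) as HW0.
  assert (HW : 0 < W) by (unfold W; lra).
  (* For the lift [z'] at parameter [d], [|z' - z| <= d B]. *)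
  set (B := W / c).
  assert (HB : 0 < B) by (apply Rdiv_lt_0_compat; assumption).
  assert (HKB : 0 < K * B) by (apply Rmult_lt_0_compat; assumption).
  (* With this tolerance the remainder [r] of the first-order lift is at most [e * d / 8]. It
     changes the squared modulus by at most [4 * Cmod r], which leaves [e * d / 2] for the quadratic
     term. *)
  destruct (Hd (e / (8 * (K * B)))) as [rho1 [Hrho1 Hd1]].
  { apply Rdiv_lt_0_compat; [exact He |]. lra. }
  fold a b in Hd1.
  (* In order, the four quotients put the target in reach of local surjectivity, keep [z'] within
     [e] of [z], keep it where the strict estimate holds, and bound [Cmod (z' - z) ^ 2] by
     [e * d / 2]. *)
  set (d0 := Rmin (Rmin (c * rho / (2 * W)) (e / B)) (Rmin (rho1 / B) (e / (2 * B * B)))).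
  assert (HBB : 0 < B * B) by (apply Rmult_lt_0_compat; assumption).
  assert (Hd0 : 0 < d0).
  { repeat apply Rmin_pos; apply Rdiv_lt_0_compat; try lra.
    apply Rmult_lt_0_compat; assumption. }
  assert (Hle : forall d x y, d < d0 -> 0 < y -> d0 <= x / y -> d * y < x).
  { intros d x y H1 H2 H3. apply Rlt_le_trans with (x / y * y).
    - apply Rmult_lt_compat_r; lra.
    - apply Req_le. field. lra. }
  exists d0; split; [exact Hd0 |]. intros d [Hdpos Hdlt].
  assert (B1 : d * (2 * W) < c * rho).
  { apply Hle; [exact Hdlt | lra |]. eapply Rle_trans; [apply Rmin_l | apply Rmin_l]. }
  assert (B2 : d * B < e).
  { apply Hle; [exact Hdlt | lra |].
    eapply Rle_trans; [apply Rmin_l | apply Rmin_r]. }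
  assert (B3 : d * B < rho1).
  { apply Hle; [exact Hdlt | lra |].
    eapply Rle_trans; [apply Rmin_r | apply Rmin_l]. }
  assert (B4 : d * (2 * B * B) < e).
  { apply Hle; [exact Hdlt | lra |].
    eapply Rle_trans; [apply Rmin_r | apply Rmin_r]. }
  assert (Hdiff : forall z', f z' = (RtoC (1 - d) * f z)%C ->
            (f z' - f z)%C = (RtoC d * (- f z))%C).
  { intros z' E. rewrite E, RtoC_minus. ring. }
  pose proof (Cmod_minus_diag z) as Hz0.
  destruct (Hsur z (RtoC (1 - d) * f z)%C) as [z' [Hz'rho E]].
  { rewrite Hz0. replace (RtoC (1 - d) * f z - f z)%C with (RtoC d * (- f z))%C
      by (rewrite RtoC_minus; ring).
    rewrite Cmod_mult, Cmod_R, Cmod_opp, Rabs_pos_eq by lra.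
    unfold W in B1. nra. }
  specialize (Hdiff z' E).
  exists z'. split; [exact E |].
  assert (Hzz : Cmod (z' - z) <= d * B).
  { specialize (Hlow z z' ltac:(lra) Hz'rho). rewrite Hdiff in Hlow.
    rewrite Cmod_mult, Cmod_R, Cmod_opp, Rabs_pos_eq in Hlow by lra.
    apply Rmult_le_reg_l with c; [exact Hc |].
    replace (c * (d * B)) with (d * W) by (unfold B; field; lra).
    unfold W. nra. }
  split; [lra |].
  specialize (Hd1 z z' ltac:(lra) ltac:(lra)). rewrite Hdiff in Hd1.
  set (v := linear_inverse a b (- f z)).
  set (r := (z' - z - RtoC d * v)%C).
  assert (Hr : Cmod r <= e * d / 8).
  { pose proof (Hinv (linear_map a b r)) as Hi.
    rewrite linear_inverse_l in Hi by lra.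
    assert (Hlr : linear_map a b r =
              (- (RtoC d * (- f z) - linear_map a b (z' - z)))%C).
    { unfold r. rewrite linear_map_minus, linear_map_scal.
      unfold v. rewrite linear_inverse_r by lra. ring. }
    rewrite Hlr, Cmod_opp in Hi.
    eapply Rle_trans; [exact Hi |].
    apply Rle_trans with (K * (e / (8 * (K * B)) * (d * B))).
    - apply Rmult_le_compat_l; [lra |]. eapply Rle_trans; [exact Hd1 |].
      apply Rmult_le_compat_l; [| exact Hzz].
      left. apply Rdiv_lt_0_compat; [exact He |]. lra.
    - apply Req_le. field. split; lra. }
  assert (Hv : Re z * Re v + Im z * Im v = - (rotation f z / cross a b)).
  { unfold v, rotation. fold a b. apply linear_inverse_inner. lra. }
  assert (Hid : Cmod z' ^ 2 - Cmod z ^ 2 + 2 * d * (rotation f z / cross a b)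
                = 2 * (Re z * Re r + Im z * Im r) + Cmod (z' - z) ^ 2).
  { rewrite !Cmod2_alt.
    assert (Er1 : Re r = Re z' - Re z - d * Re v)
      by (unfold r, Re; simpl; ring).
    assert (Er2 : Im r = Im z' - Im z - d * Im v)
      by (unfold r, Im; simpl; ring).
    assert (Ed1 : Re (z' - z) = Re z' - Re z) by (unfold Re; simpl; ring).
    assert (Ed2 : Im (z' - z) = Im z' - Im z) by (unfold Im; simpl; ring).
    rewrite Er1, Er2, Ed1, Ed2.
    replace (rotation f z / cross a b) with (- (Re z * Re v + Im z * Im v)) by lra.
    ring. }
  rewrite Hid.
  pose proof (re_le_Cmod z). pose proof (im_le_Cmod z).
  pose proof (re_le_Cmod r). pose proof (im_le_Cmod r).
  pose proof (Rabs_pos (Re z)). pose proof (Rabs_pos (Im z)).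
  pose proof (Rabs_pos (Re r)). pose proof (Rabs_pos (Im r)).
  eapply Rle_trans; [apply Rabs_triang |].
  rewrite Rabs_mult, (Rabs_pos_eq 2), (Rabs_pos_eq (Cmod _ ^ 2))
    by (try apply pow2_ge_0; lra).
  assert (Hin : Rabs (Re z * Re r + Im z * Im r) <= 2 * Cmod r).
  { eapply Rle_trans; [apply Rabs_triang |]. rewrite !Rabs_mult.
    assert (Rabs (Re z) * Rabs (Re r) <= 1 * Cmod r)
      by (apply Rmult_le_compat; lra).
    assert (Rabs (Im z) * Rabs (Im r) <= 1 * Cmod r)
      by (apply Rmult_le_compat; lra).
    lra. }
  assert (Hsq : Cmod (z' - z) ^ 2 <= d * (e / 2)).
  { pose proof (Cmod_ge_0 (z' - z)). apply Rle_trans with ((d * B) ^ 2).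
    - apply pow_incr. lra.
    - nra. }
  lra.
Qed.

(** * Lifts inside a disk where the rotation is nonnegative *)

Lemma Cmod_minus_0 (z : C) : Cmod (z - 0) = Cmod z.
Proof. f_equal. ring. Qed.

Lemma scale_minus_self (t : R) (w : C) :
  0 <= t -> Cmod (RtoC (1 - t) * w - w) = t * Cmod w.
Proof.
  intros Ht. replace (RtoC (1 - t) * w - w)%C with (RtoC (- t) * w)%C
    by (rewrite RtoC_minus, RtoC_opp; ring).
  rewrite Cmod_mult, Cmod_R, Rabs_Ropp, Rabs_pos_eq by exact Ht. reflexivity.
Qed.

Lemma scale_minus_scale (s s' : R) (w : C) :
  Cmod (RtoC (1 - s') * w - RtoC (1 - s) * w) = Rabs (s - s') * Cmod w.
Proof.
  rewrite <- Cmod_R, <- Cmod_mult. f_equal. rewrite !RtoC_minus. ring.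
Qed.

(** Continuous induction along the segment, made of first-order steps. Each step may raise the
    squared modulus a little, and the total is budgeted as [e * s]; since the start lies deeper than
    [e] inside the circle of radius [rad], the lift never leaves the open disk where the sign is
    known. The expansion bound about [u] controls the displacement from [u1]. *)
Lemma slack_lift f rad u rho c u1 b e :
  regular f -> 0 <= rad <= 1 -> (forall z, Cmod z < rad -> 0 <= rotation f z) ->
  0 < c ->
  (forall z z', Cmod (z - u) < rho -> Cmod (z' - u) < rho ->
     c * Cmod (z' - z) <= Cmod (f z' - f z)) ->
  0 < e -> Cmod u1 ^ 2 + e < rad ^ 2 -> 0 <= b <= 1 ->
  c * Cmod (u1 - u) + b * Cmod (f u1) < c * rho ->
  exists z, c * Cmod (z - u1) <= b * Cmod (f u1) /\
    Cmod z ^ 2 <= Cmod u1 ^ 2 + e * b /\ f z = (RtoC (1 - b) * f u1)%C.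
Proof.
  intros Hf HR HQ Hc Hlow He Hu1 Hb Hball.
  pose proof (Cmod_ge_0 (f u1)) as Hf1.
  assert (Hin : forall s z, 0 <= s <= b -> Cmod z ^ 2 <= Cmod u1 ^ 2 + e * s -> Cmod z < rad).
  { intros s z Hs Hz. apply Rnot_le_lt; intros H.
    assert (rad ^ 2 <= Cmod z ^ 2) by (apply pow_incr; lra). nra. }
  assert (Hinb : forall s z, 0 <= s <= b ->
            c * Cmod (z - u1) <= s * Cmod (f u1) -> Cmod (z - u) < rho).
  { intros s z Hs Hz. pose proof (Cmod_minus_triangle z u1 u).
    assert (s * Cmod (f u1) <= b * Cmod (f u1)) by (apply Rmult_le_compat_r; lra).
    apply Rmult_lt_reg_l with c; [exact Hc |]. nra. }
  apply (real_induction b (fun s => exists z,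
    c * Cmod (z - u1) <= s * Cmod (f u1) /\
    Cmod z ^ 2 <= Cmod u1 ^ 2 + e * s /\ f z = (RtoC (1 - s) * f u1)%C)); [lra | | |].
  - exists u1. rewrite Cmod_minus_diag. repeat split; [lra | lra |].
    rewrite Rminus_0_r. ring.
  - intros s Hs [z [Hz1 [Hz2 Hz3]]].
    assert (HzR : Cmod z < rad) by (apply (Hin s); [lra | exact Hz2]).
    assert (Hzu : Cmod (z - u) < rho) by (apply (Hinb s); [lra | exact Hz1]).
    (* A relative step [d] at parameter [s] advances the parameter by [d * (1 - s)] only, because
       [(1 - d) * (1 - s) = 1 - (s + d * (1 - s))]; hence the factor [1 - s] in the tolerance. *)
    destruct (radial_step f z Hf ltac:(lra) (Rmin (e * (1 - s)) (rho - Cmod (z - u))))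
      as [d0 [Hd0 Hd]].
    { apply Rmin_pos; [apply Rmult_lt_0_compat; lra | lra]. }
    set (d := Rmin (d0 / 2) (b - s)).
    assert (Hdpos : 0 < d) by (apply Rmin_pos; lra).
    assert (Hd1 : d <= d0 / 2) by apply Rmin_l.
    assert (Hd2 : d <= b - s) by apply Rmin_r.
    destruct (Hd d ltac:(lra)) as [z' [E [Hz' Hsq]]].
    assert (Hm1 := Rmin_l (e * (1 - s)) (rho - Cmod (z - u))).
    assert (Hm2 := Rmin_r (e * (1 - s)) (rho - Cmod (z - u))).
    set (e1 := Rmin (e * (1 - s)) (rho - Cmod (z - u))) in *.
    exists (s + d * (1 - s)).
    assert (Es : f z' = (RtoC (1 - (s + d * (1 - s))) * f u1)%C).
    { rewrite E, Hz3, Cmult_assoc, <- RtoC_mult. do 2 f_equal. ring. }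
    assert (Hs' : s < s + d * (1 - s) <= b) by nra.
    split; [exact Hs' |].
    exists z'. repeat split; [| | exact Es].
    + assert (H1 : Cmod (z' - u) < rho) by (pose proof (Cmod_minus_triangle z' z u); lra).
      assert (H2 : Cmod (u1 - u) < rho) by (apply (Hinb 0); [lra |]; rewrite Cmod_minus_diag; lra).
      pose proof (Hlow u1 z' H2 H1) as H3. rewrite Es, scale_minus_self in H3 by lra.
      exact H3.
    + assert (Hq : 0 <= rotation f z / cross (partial_x f z) (partial_y f z)).
      { apply Rdiv_le_0_compat; [apply HQ; exact HzR | apply Hf; lra]. }
      set (q := rotation f z / cross (partial_x f z) (partial_y f z)) in *.
      apply Rabs_le_between in Hsq.
      assert (0 <= d * q) by (apply Rmult_le_pos; lra).
      assert (e1 * d <= e * (1 - s) * d) by (apply Rmult_le_compat_r; lra).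
      lra.
  - intros s Hs Hlim.
    (* Lifts with parameters tending to [s] cluster at some [a]. The modulus bound is put in the
       form [Cmod z <= m] so that it passes to the limit. *)
    set (m := sqrt (Cmod u1 ^ 2 + e * s)).
    assert (Hpos : 0 <= Cmod u1 ^ 2 + e * s) by (pose proof (pow2_ge_0 (Cmod u1)); nra).
    assert (Hmsq : m ^ 2 = Cmod u1 ^ 2 + e * s) by (apply pow2_sqrt; exact Hpos).
    assert (Hm0 : 0 <= m) by apply sqrt_pos.
    destruct (cluster_C (fun eta z => exists s', s - eta < s' <= s /\ 0 <= s' /\
        c * Cmod (z - u1) <= s' * Cmod (f u1) /\
        Cmod z ^ 2 <= Cmod u1 ^ 2 + e * s' /\ f z = (RtoC (1 - s') * f u1)%C)
      (fun z => z) rad) as [a Ha].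
    + intros eta eta' z Heta [s' [Hs' H]]. exists s'. split; [lra | exact H].
    + intros eta Heta. destruct (Hlim eta Heta) as [s' [Hs' [Hs0 [z Hz]]]].
      exists z, s'. tauto.
    + intros eta z [s' [Hs' [Hs0 [_ [Hz _]]]]]. left. apply (Hin s'); [lra | exact Hz].
    + assert (Ham : Cmod a <= m).
      { rewrite <- Cmod_minus_0. apply Cmod_limit_le. intros eta Heta.
        destruct (Ha eta Heta) as [z [[s' [Hs' [Hs0 [_ [Hz _]]]]] Hza]].
        exists z; split; [exact Hza |]. rewrite Cmod_minus_0.
        apply Rnot_lt_le; intros H.
        assert (m ^ 2 < Cmod z ^ 2) by nra. nra. }
      assert (Hasq : Cmod a ^ 2 <= Cmod u1 ^ 2 + e * s).
      { rewrite <- Hmsq. apply pow_incr. split; [apply Cmod_ge_0 | exact Ham]. }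
      exists a. repeat split; [| exact Hasq |].
      * assert (Cmod (a - u1) <= s * Cmod (f u1) / c).
        { apply Cmod_limit_le. intros eta Heta.
          destruct (Ha eta Heta) as [z [[s' [Hs' [Hs0 [Hz _]]]] Hza]].
          exists z; split; [exact Hza |].
          apply Rmult_le_reg_l with c; [exact Hc |].
          replace (c * (s * Cmod (f u1) / c)) with (s * Cmod (f u1)) by (field; lra).
          eapply Rle_trans; [exact Hz |]. apply Rmult_le_compat_r; lra. }
        replace (s * Cmod (f u1)) with (c * (s * Cmod (f u1) / c)) by (field; lra).
        apply Rmult_le_compat_l; lra.
      * apply (regular_limit f a _ (Cmod (f u1)) Hf).
        { assert (Cmod a < rad) by (apply (Hin s); [lra | exact Hasq]). lra. }
        intros eta Heta.
        destruct (Ha eta Heta) as [z [[s' [Hs' [Hs0 [_ [_ Hz]]]]] Hza]].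
        exists z; split; [exact Hza |]. rewrite Hz, scale_minus_scale.
        rewrite Rabs_pos_eq by lra. rewrite Rmult_comm. apply Rmult_le_compat_l; lra.
Qed.

(** Moving [u] slightly towards the origin gives starting points strictly inside its circle, where
    [slack_lift] applies. *)
Lemma shrink f u : regular f -> 0 < Cmod u < 1 ->
  forall eta, 0 < eta -> exists u1, Cmod (u1 - u) < eta /\ Cmod (f u1 - f u) < eta /\
    Cmod u1 < Cmod u.
Proof.
  intros Hf Hu eta Heta.
  destruct (strictly_differentiable_continuous f u) as [rho [L [Hrho [HL HLf]]]].
  { apply Hf; lra. }
  set (k := Rmin (1 / 2) (Rmin (rho / 2) (Rmin (eta / 2) (eta / (2 * L))))).
  assert (Hk : 0 < k) by (repeat apply Rmin_pos; try apply Rdiv_lt_0_compat; lra).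
  assert (K1 : k <= 1 / 2) by apply Rmin_l.
  assert (K2 : k <= rho / 2) by (eapply Rle_trans; [apply Rmin_r | apply Rmin_l]).
  assert (K3 : k <= eta / 2)
    by (do 2 (eapply Rle_trans; [apply Rmin_r |]); apply Rmin_l).
  assert (K4 : k <= eta / (2 * L))
    by (do 2 (eapply Rle_trans; [apply Rmin_r |]); apply Rmin_r).
  assert (K5 : L * k <= eta / 2).
  { replace (eta / 2) with (L * (eta / (2 * L))) by (field; lra).
    apply Rmult_le_compat_l; lra. }
  set (u1 := (RtoC (1 - k) * u)%C).
  assert (Hu1 : Cmod (u1 - u) <= k) by (unfold u1; rewrite scale_minus_self by lra; nra).
  exists u1. repeat split; [lra | |].
  - eapply Rle_lt_trans; [apply HLf |].
    + rewrite Cmod_minus_diag. exact Hrho.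
    + lra.
    + nra.
  - unfold u1. rewrite Cmod_mult, Cmod_R, Rabs_pos_eq by lra. nra.
Qed.

(* A zero [a <> 0] would attract the lifts of radial segments starting at points
   of smaller modulus, although the modulus does not increase along lifts. *)
Lemma zero_unique f rad a : regular f -> rad < 1 ->
  (forall z, Cmod z < rad -> 0 <= rotation f z) ->
  Cmod a <= rad -> f a = 0%C -> a = 0%C.
Proof.
  intros Hf HR HQ HaR Ha.
  destruct (Ceq_dec a 0) as [E | E]; [exact E | exfalso].
  apply Cmod_gt_0 in E.
  destruct (local_homeo f a Hf ltac:(lra)) as [rho [c [Hrho [Hc [_ [Hlow _]]]]]].
  (* The tolerance [eta] solves [c * eta + eta = c * rho], which is the room that a full lift
     needs. *)
  destruct (shrink f a Hf ltac:(lra) (c * rho / (1 + c))) as [u1 [H1 [H2 H3]]].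
  { apply Rdiv_lt_0_compat; [apply Rmult_lt_0_compat; assumption | lra]. }
  rewrite Ha, Cmod_minus_0 in H2.
  assert (Hball : c * Cmod (u1 - a) + 1 * Cmod (f u1) < c * rho).
  { apply Rlt_le_trans with (c * (c * rho / (1 + c)) + c * rho / (1 + c)).
    - assert (c * Cmod (u1 - a) < c * (c * rho / (1 + c))) by (apply Rmult_lt_compat_l; lra).
      lra.
    - apply Req_le. field. lra. }
  assert (Hsq : Cmod u1 ^ 2 < Cmod a ^ 2) by (pose proof (Cmod_ge_0 u1); nra).
  (* The full lift, [b = 1], ends at a zero close to [a], hence at [a] by local injectivity. With
     half the gap as slack, its squared modulus is still below that of [a]. *)
  destruct (slack_lift f (Cmod a) a rho c u1 1 ((Cmod a ^ 2 - Cmod u1 ^ 2) / 2))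
    as [z [Hz1 [Hz2 Hz3]]]; try lra; try assumption.
  { intros z Hz. apply HQ. lra. }
  replace (1 - 1) with 0 in Hz3 by ring. rewrite Cmult_0_l in Hz3.
  assert (Hza : Cmod (z - a) < rho).
  { pose proof (Cmod_minus_triangle z u1 a).
    apply Rmult_lt_reg_l with c; [exact Hc | nra]. }
  assert (Haa : Cmod (a - a) < rho) by (rewrite Cmod_minus_diag; exact Hrho).
  pose proof (Hlow a z Haa Hza) as Hz. rewrite Hz3, Ha, Cmod_minus_diag in Hz.
  assert (z = a); [| subst z; lra].
  apply Cmod_minus_eq_0. pose proof (Cmod_ge_0 (z - a)). nra.
Qed.

(* The sign condition is only known in the open disk, so a lift starting on the
   circle is obtained as a limit of lifts starting inside. *)
Lemma lift f rad u e : regular f -> f 0%C = 0%C -> rad < 1 ->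
  (forall z, Cmod z < rad -> 0 <= rotation f z) ->
  Cmod u <= rad -> 0 < e ->
  exists b0, 0 < b0 <= 1 /\ forall b, 0 <= b <= b0 ->
    exists z, Cmod z <= rad /\ Cmod (z - u) < e /\ f z = (RtoC (1 - b) * f u)%C.
Proof.
  intros Hf Hf0 HR HQ HuR He.
  (* The origin cannot be moved inwards, but it is its own lift because [f] vanishes there. *)
  destruct (Ceq_dec u 0) as [E | E].
  { subst u. exists 1. split; [lra |]. intros b _. exists 0%C.
    repeat split; [exact HuR | rewrite Cmod_minus_diag; exact He |].
    rewrite Hf0. ring. }
  apply Cmod_gt_0 in E.
  destruct (local_homeo f u Hf ltac:(lra)) as [rho [c [Hrho [Hc [_ [Hlow _]]]]]].
  (* One bound for [Cmod (f u1)] that serves all starting points [u1] near [u]. *)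
  set (F := Cmod (f u) + 1).
  assert (HF : 1 <= F) by (unfold F; pose proof (Cmod_ge_0 (f u)); lra).
  set (g := Rmin rho e).
  assert (Hg : 0 < g) by (apply Rmin_pos; assumption).
  assert (Hg1 : g <= rho) by apply Rmin_l.
  assert (Hg2 : g <= e) by apply Rmin_r.
  assert (Hcg : 0 < c * g) by (apply Rmult_lt_0_compat; assumption).
  (* This makes [b * F] at most [c * g / 4], so every approximate lift moves by at most [g / 4]. *)
  exists (Rmin 1 (c * g / (4 * F))). split.
  { split; [apply Rmin_pos; [lra | apply Rdiv_lt_0_compat; lra] | apply Rmin_l]. }
  intros b [Hb0 Hb].
  assert (Hb1 : b <= 1) by (eapply Rle_trans; [exact Hb | apply Rmin_l]).
  assert (HbF : b * F <= c * g / 4).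
  { apply Rle_trans with (c * g / (4 * F) * F).
    - apply Rmult_le_compat_r; [lra |].
      eapply Rle_trans; [exact Hb | apply Rmin_r].
    - apply Req_le. field. lra. }
  destruct (cluster_C (fun eta z => exists u1, Cmod (u1 - u) < eta /\
      Cmod (f u1 - f u) < eta /\ Cmod z <= rad /\ c * Cmod (z - u1) <= b * F /\
      f z = (RtoC (1 - b) * f u1)%C) (fun z => z) rad) as [a Ha].
  - intros eta eta' z Heta [u1 [H1 [H2 H]]]. exists u1.
    repeat split; [lra | lra | tauto ..].
  - intros eta Heta.
    destruct (shrink f u Hf ltac:(lra) (Rmin eta (Rmin 1 (g / 2)))) as [u1 [H1 [H2 H3]]].
    { repeat apply Rmin_pos; lra. }
    assert (M1 := Rmin_l eta (Rmin 1 (g / 2))).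
    assert (M2 := Rmin_r eta (Rmin 1 (g / 2))).
    assert (M3 := Rmin_l 1 (g / 2)). assert (M4 := Rmin_r 1 (g / 2)).
    assert (HfF : Cmod (f u1) <= F)
      by (unfold F; pose proof (Cmod_le_minus (f u1) (f u)); lra).
    assert (HbfF : b * Cmod (f u1) <= b * F) by (apply Rmult_le_compat_l; lra).
    assert (Hsq : Cmod u1 ^ 2 < rad ^ 2) by (pose proof (Cmod_ge_0 u1); nra).
    destruct (slack_lift f rad u rho c u1 b ((rad ^ 2 - Cmod u1 ^ 2) / 2))
      as [z [Hz1 [Hz2 Hz3]]]; try lra; try assumption.
    { assert (c * Cmod (u1 - u) <= c * (g / 2)) by (apply Rmult_le_compat_l; lra).
      assert (c * g <= c * rho) by (apply Rmult_le_compat_l; lra). lra. }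
    exists z, u1. repeat split; [lra | lra | | lra | exact Hz3].
    apply Rnot_lt_le; intros H.
    assert (rad ^ 2 < Cmod z ^ 2) by nra. nra.
  - intros eta z [u1 [_ [_ [Hz _]]]]. exact Hz.
  - assert (HaR : Cmod a <= rad).
    { rewrite <- Cmod_minus_0. apply Cmod_limit_le. intros eta Heta.
      destruct (Ha eta Heta) as [z [[u1 [_ [_ [Hz _]]]] Hza]].
      exists z; split; [exact Hza | rewrite Cmod_minus_0; exact Hz]. }
    exists a. repeat split; [exact HaR | |].
    + destruct (Ha (g / 4)) as [z [[u1 [H1 [_ [_ [H2 _]]]]] Hza]]; [lra |].
      assert (Cmod (z - u1) <= g / 4) by (apply Rmult_le_reg_l with c; lra).
      pose proof (Cmod_minus_triangle a z u). pose proof (Cmod_minus_triangle z u1 u).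
      rewrite (Cmod_minus_sym a z) in *. lra.
    + apply (regular_limit f a _ 1 Hf ltac:(lra)). intros eta Heta.
      destruct (Ha eta Heta) as [z [[u1 [_ [H1 [_ [_ H2]]]]] Hza]].
      exists z; split; [exact Hza |]. rewrite H2.
      replace (RtoC (1 - b) * f u1 - RtoC (1 - b) * f u)%C
        with (RtoC (1 - b) * (f u1 - f u))%C by ring.
      rewrite Cmod_mult, Cmod_R, Rabs_pos_eq by lra.
      pose proof (Cmod_ge_0 (f u1 - f u)). nra.
Qed.

(** * Injectivity on closed disks *)

(** Compactness for pairs of distinct points with equal values: the limit pair cannot collapse
    because [f] is injective near each point. [T] carries further data on the first point, such as
    the lifting parameter. *)
Lemma distinct_pair_limit f rad (T : R -> C -> Prop) : regular f -> rad < 1 ->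
  (forall e e' u, e <= e' -> T e u -> T e' u) ->
  (forall e, 0 < e -> exists u v, u <> v /\ Cmod u <= rad + e /\ Cmod v <= rad + e /\
     f u = f v /\ T e u) ->
  exists a b, a <> b /\ Cmod a <= rad /\ Cmod b <= rad /\ f a = f b /\
    forall e, 0 < e -> exists u, T e u /\ Cmod (u - a) < e.
Proof.
  intros Hf HR HT H.
  (* The bounds by [rad + 1] are independent of the tolerance, as [cluster_C] demands. *)
  set (P := fun e (x : C * C) => fst x <> snd x /\ f (fst x) = f (snd x) /\
              Cmod (fst x) <= rad + e /\ Cmod (snd x) <= rad + e /\
              Cmod (fst x) <= rad + 1 /\ Cmod (snd x) <= rad + 1 /\ T e (fst x)).
  assert (Pmono : forall e e' x, e <= e' -> P e x -> P e' x).
  { intros e e' x He [H1 [H2 [H3 [H4 [H5 [H6 H7]]]]]].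
    repeat split; try assumption; try lra. exact (HT e e' _ He H7). }
  destruct (cluster_C P fst (rad + 1) Pmono) as [a Ha].
  { intros e He. destruct (H (Rmin e 1)) as [u [v [H1 [H2 [H3 [H4 H5]]]]]].
    { apply Rmin_pos; lra. }
    assert (M1 := Rmin_l e 1). assert (M2 := Rmin_r e 1).
    exists (u, v). repeat split; simpl; try assumption; try lra.
    exact (HT _ _ _ M1 H5). }
  { intros e x Hx. apply Hx. }
  destruct (cluster_C (fun e x => P e x /\ Cmod (fst x - a) < e) snd (rad + 1)) as [b Hb].
  { intros e e' x He [H1 H2]. split; [exact (Pmono e e' x He H1) | lra]. }
  { exact Ha. }
  { intros e x [Hx _]. apply Hx. }
  assert (Hlim : forall z, (forall e, 0 < e -> exists x, Cmod x <= rad + e /\ Cmod (x - z) < e) ->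
            Cmod z <= rad).
  { intros z Hz. apply le_epsilon. intros e He.
    destruct (Hz (e / 2)) as [x [H1 H2]]; [lra |].
    pose proof (Cmod_le_minus z x). rewrite Cmod_minus_sym in H2. lra. }
  assert (Har : Cmod a <= rad).
  { apply Hlim. intros e He. destruct (Ha e He) as [x [Hx Hxa]].
    exists (fst x). split; [apply Hx | exact Hxa]. }
  assert (Hbr : Cmod b <= rad).
  { apply Hlim. intros e He. destruct (Hb e He) as [x [[Hx _] Hxb]].
    exists (snd x). split; [apply Hx | exact Hxb]. }
  exists a, b. repeat split; [| exact Har | exact Hbr | |].
  - intros <-.
    destruct (local_homeo f a Hf ltac:(lra)) as [rho [c [Hrho [Hc [_ [Hlow _]]]]]].
    destruct (Hb rho Hrho) as [[u v] [[[H1 [H2 _]] H3] H4]]; simpl in *.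
    apply H1, Cmod_minus_eq_0. pose proof (Hlow v u H4 H3) as H5.
    rewrite H2, Cmod_minus_diag in H5. pose proof (Cmod_ge_0 (u - v)). nra.
  - destruct (strictly_differentiable_continuous f b) as [rho [L [Hrho [HL HLf]]]].
    { apply Hf; lra. }
    apply (regular_limit f a (f b) L Hf ltac:(lra)). intros e He.
    destruct (Hb (Rmin e rho)) as [[u v] [[[_ [H2 _]] H3] H4]];
      [apply Rmin_pos; assumption |]; simpl in *.
    assert (M1 := Rmin_l e rho). assert (M2 := Rmin_r e rho).
    exists u. split; [lra |]. rewrite H2.
    eapply Rle_trans; [apply HLf |].
    + rewrite Cmod_minus_diag. exact Hrho.
    + lra.
    + apply Rmult_le_compat_l; lra.
  - intros e He. destruct (Ha e He) as [x [Hx Hxa]].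
    exists (fst x). split; [apply Hx | exact Hxa].
Qed.

(** Two distinct points with a common value are carried along lifts of the same segment. Each moves
    by less than half their distance, so they stay distinct, and distinctness survives limits by
    [distinct_pair_limit]. At the end both are zeros, which [zero_unique] forbids. *)
Lemma injective_closed_disk f rad : regular f -> f 0%C = 0%C -> 0 <= rad < 1 ->
  (forall z, Cmod z < rad -> 0 <= rotation f z) ->
  forall u v, Cmod u <= rad -> Cmod v <= rad -> f u = f v -> u = v.
Proof.
  intros Hf Hf0 HR HQ u v Hu Hv E.
  apply NNPP; intros Huv.
  assert (H1 : exists u' v', u' <> v' /\ Cmod u' <= rad /\ Cmod v' <= rad /\
            f u' = f v' /\ f u' = (RtoC (1 - 1) * f u)%C).
  { apply (real_induction 1 (fun s => exists u' v', u' <> v' /\ Cmod u' <= rad /\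
      Cmod v' <= rad /\ f u' = f v' /\ f u' = (RtoC (1 - s) * f u)%C)); [lra | | |].
    - exists u, v. repeat split; try assumption. rewrite Rminus_0_r. ring.
    - intros s Hs [u' [v' [Hne [Hu' [Hv' [E1 E2]]]]]].
      assert (He : 0 < Cmod (u' - v') / 2).
      { assert (0 < Cmod (u' - v')); [| lra].
        apply Cmod_gt_0. intros H0. apply Hne, Cmod_minus_eq_0. rewrite H0, Cmod_0. lra. }
      destruct (lift f rad u' _ Hf Hf0 ltac:(lra) HQ Hu' He) as [b1 [Hb1 L1]].
      destruct (lift f rad v' _ Hf Hf0 ltac:(lra) HQ Hv' He) as [b2 [Hb2 L2]].
      set (b := Rmin b1 b2).
      assert (Hb : 0 < b) by (apply Rmin_pos; lra).
      assert (M1 : b <= b1) by apply Rmin_l. assert (M2 : b <= b2) by apply Rmin_r.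
      destruct (L1 b ltac:(lra)) as [u'' [Hu1 [Hu2 Hu3]]].
      destruct (L2 b ltac:(lra)) as [v'' [Hv1 [Hv2 Hv3]]].
      exists (s + b * (1 - s)). split; [nra |].
      exists u'', v''. repeat split; try assumption.
      + intros <-. rewrite Cmod_minus_sym in Hu2.
        pose proof (Cmod_minus_triangle u' u'' v'). lra.
      + rewrite Hu3, Hv3, E1. reflexivity.
      + rewrite Hu3, E2, Cmult_assoc, <- RtoC_mult. do 2 f_equal. ring.
    - intros s Hs Hlim.
      destruct (distinct_pair_limit f rad (fun eta u' => exists s', s - eta < s' <= s /\
        f u' = (RtoC (1 - s') * f u)%C) Hf ltac:(lra)) as [a [b [H1 [H2 [H3 [H4 H5]]]]]].
      + intros e e' u' He [s' [Hs' H]]. exists s'. split; [lra | exact H].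
      + intros e He. destruct (Hlim e He) as [s' [Hs' [_ [u' [v' [H1 [H2 [H3 [H4 H5]]]]]]]]].
        exists u', v'. repeat split; try assumption; try lra.
        exists s'. split; assumption.
      + exists a, b. repeat split; try assumption.
        apply (regular_limit f a _ (Cmod (f u)) Hf ltac:(lra)). intros e He.
        destruct (H5 e He) as [u' [[s' [Hs' E']] Hu'a]].
        exists u'. split; [exact Hu'a |]. rewrite E', scale_minus_scale.
        rewrite Rabs_pos_eq by lra. rewrite Rmult_comm.
        apply Rmult_le_compat_l; [apply Cmod_ge_0 | lra]. }
  destruct H1 as [u' [v' [Hne [Hu' [Hv' [E1 E2]]]]]].
  replace (1 - 1) with 0 in E2 by ring. rewrite Cmult_0_l in E2.
  apply Hne. transitivity (RtoC 0).
  - exact (zero_unique f rad u' Hf ltac:(lra) HQ Hu' E2).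
  - symmetry. apply (zero_unique f rad v' Hf ltac:(lra) HQ Hv'). congruence.
Qed.

(** * Starlike images force a nonnegative rotation *)

Lemma injective_rotation_nonneg f rad : regular f -> rad <= 1 ->
  (forall u v, Cmod u < rad -> Cmod v < rad -> f u = f v -> u = v) ->
  (forall r, 0 < r < 1 -> starlike_wrt_origin (image f (disk r))) ->
  forall z, Cmod z < rad -> 0 <= rotation f z.
Proof.
  intros Hf HR Hinj Hstar z Hz. apply Rnot_lt_le; intros HQ.
  assert (HJ : 0 < cross (partial_x f z) (partial_y f z)) by (apply Hf; lra).
  set (q := - (rotation f z / cross (partial_x f z) (partial_y f z))).
  assert (Hq : 0 < q).
  { unfold q, Rdiv. rewrite <- Ropp_mult_distr_l_reverse.
    apply Rmult_lt_0_compat; [lra | apply Rinv_0_lt_compat; exact HJ]. }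
  (* The bound [q] on the error leaves a gain of at least [d * q] in the squared modulus; the bound
     [rad - Cmod z] keeps [z'] in the disk of injectivity. *)
  destruct (radial_step f z Hf ltac:(lra) (Rmin q (rad - Cmod z))) as [d0 [Hd0 Hd]].
  { apply Rmin_pos; lra. }
  assert (M1 := Rmin_l q (rad - Cmod z)). assert (M2 := Rmin_r q (rad - Cmod z)).
  set (d := Rmin (d0 / 2) 1).
  assert (Hdp : 0 < d) by (apply Rmin_pos; lra).
  assert (Hd1 : d <= d0 / 2) by apply Rmin_l. assert (Hd2 : d <= 1) by apply Rmin_r.
  destruct (Hd d ltac:(lra)) as [z' [E [Hz' Hsq]]].
  apply Rabs_le_between in Hsq.
  replace (rotation f z / cross (partial_x f z) (partial_y f z)) with (- q) in Hsq
    by (unfold q; ring).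
  assert (Hgt : Cmod z < Cmod z').
  { assert (Rmin q (rad - Cmod z) * d <= q * d) by (apply Rmult_le_compat_r; lra).
    pose proof (Rmult_lt_0_compat _ _ Hdp Hq).
    pose proof (Cmod_ge_0 z). pose proof (Cmod_ge_0 z').
    assert (Cmod z ^ 2 < Cmod z' ^ 2) by lra. nra. }
  assert (Hz'r : Cmod z' < rad) by (pose proof (Cmod_le_minus z' z); lra).
  pose proof (Cmod_ge_0 z).
  (* The open disk of radius [Cmod z'] contains [z] but not [z']. Starlikeness of its image gives a
     preimage of [f z'] inside it, which injectivity identifies with [z']. *)
  destruct (Hstar (Cmod z')) as [_ Hs]; [lra |].
  destruct (Hs (f z) (1 - d)) as [z'' [Hz'' E'']].
  { exists z. split; [exact Hgt | reflexivity]. }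
  { lra. }
  unfold disk in Hz''.
  assert (z'' = z') by (apply Hinj; [lra | lra | congruence]).
  subst z''. lra.
Qed.

Lemma starlike_rotation_nonneg f : regular f -> f 0%C = 0%C ->
  (forall r, 0 < r < 1 -> starlike_wrt_origin (image f (disk r))) ->
  forall z, Cmod z < 1 -> 0 <= rotation f z.
Proof.
  intros Hf Hf0 Hstar z0 Hz0. apply Rnot_lt_le; intros HQ0.
  destruct (completeness (fun r => r <= 1 /\ forall z, Cmod z < r -> 0 <= rotation f z))
    as [rad [Hub Hlub]].
  { exists 1. intros r [Hr _]. exact Hr. }
  { exists 0. split; [lra |]. intros z Hz. pose proof (Cmod_ge_0 z). lra. }
  assert (Hr0 : 0 <= rad).
  { apply Hub. split; [lra |]. intros z Hz. pose proof (Cmod_ge_0 z). lra. }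
  assert (Hrz : rad <= Cmod z0).
  { apply Hlub. intros r [_ Hr]. apply Rnot_lt_le; intros H. specialize (Hr z0 H). lra. }
  assert (HQ : forall z, Cmod z < rad -> 0 <= rotation f z).
  { intros z Hz. apply Rnot_lt_le; intros HQz.
    assert (rad <= Cmod z); [| lra].
    apply Hlub. intros r [_ Hr]. apply Rnot_lt_le; intros H. specialize (Hr z H). lra. }
  (* If injectivity failed on every larger disk, the offending pairs would cluster at such a pair in
     the closed disk of radius [rad]. *)
  assert (Hinj : exists e, 0 < e /\ forall u v, Cmod u <= rad + e -> Cmod v <= rad + e ->
            f u = f v -> u = v).
  { apply NNPP; intros Hn.
    destruct (distinct_pair_limit f rad (fun _ _ => True) Hf ltac:(lra))
      as [a [b [H1 [H2 [H3 [H4 _]]]]]].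
    - trivial.
    - intros e He. apply NNPP; intros Hn'. apply Hn.
      exists e. split; [exact He |]. intros u v Hu Hv E.
      apply NNPP; intros Hne. apply Hn'. exists u, v. tauto.
    - apply H1. exact (injective_closed_disk f rad Hf Hf0 ltac:(lra) HQ a b H2 H3 H4). }
  destruct Hinj as [e [He Hinj]].
  set (e' := Rmin e (1 - rad)).
  assert (He' : 0 < e') by (apply Rmin_pos; lra).
  assert (M1 : e' <= e) by apply Rmin_l. assert (M2 : e' <= 1 - rad) by apply Rmin_r.
  assert (rad + e' <= rad); [| lra].
  apply Hub. split; [lra |].
  apply injective_rotation_nonneg; [exact Hf | lra | | exact Hstar].
  intros u v Hu Hv. apply Hinj; lra.
Qed.

(** * Nonnegative rotation gives starlike domains *)

(** Every step is a [lift] within the closed disk of the fixed radius [Cmod z], so the modulus bound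
    does not deteriorate as steps accumulate. *)
Lemma rotation_nonneg_lift f : regular f -> f 0%C = 0%C ->
  (forall z, Cmod z < 1 -> 0 <= rotation f z) ->
  forall z t, Cmod z < 1 -> 0 <= t <= 1 ->
    exists z', Cmod z' <= Cmod z /\ f z' = (RtoC t * f z)%C.
Proof.
  intros Hf Hf0 HQ z t Hz Ht.
  replace t with (1 - (1 - t)) by ring.
  apply (real_induction (1 - t)
    (fun s => exists z', Cmod z' <= Cmod z /\ f z' = (RtoC (1 - s) * f z)%C)); [lra | | |].
  - exists z. split; [lra |]. rewrite Rminus_0_r. ring.
  - intros s Hs [z' [Hz' E]].
    destruct (lift f (Cmod z) z' 1 Hf Hf0 Hz) as [b0 [Hb0 Hb]]; [| exact Hz' | lra |].
    { intros x Hx. apply HQ. lra. }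
    set (b := Rmin b0 (1 - t - s)).
    assert (Hbp : 0 < b) by (apply Rmin_pos; lra).
    assert (M1 : b <= b0) by apply Rmin_l. assert (M2 : b <= 1 - t - s) by apply Rmin_r.
    destruct (Hb b ltac:(lra)) as [z'' [H1 [_ H2]]].
    exists (s + b * (1 - s)). split; [nra |].
    exists z''. split; [exact H1 |].
    rewrite H2, E, Cmult_assoc, <- RtoC_mult. do 2 f_equal. ring.
  - intros s Hs Hlim.
    destruct (cluster_C (fun eta z' => exists s', s - eta < s' <= s /\
      Cmod z' <= Cmod z /\ f z' = (RtoC (1 - s') * f z)%C) (fun z => z) (Cmod z)) as [a Ha].
    + intros eta eta' z' Heta [s' [Hs' H]]. exists s'. split; [lra | exact H].
    + intros eta Heta. destruct (Hlim eta Heta) as [s' [Hs' [_ [z' H]]]].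
      exists z', s'. tauto.
    + intros eta z' [s' [_ [H _]]]. exact H.
    + assert (Haz : Cmod a <= Cmod z).
      { rewrite <- Cmod_minus_0. apply Cmod_limit_le. intros eta Heta.
        destruct (Ha eta Heta) as [z' [[s' [_ [H _]]] H']].
        exists z'. rewrite Cmod_minus_0. split; assumption. }
      exists a. split; [exact Haz |].
      apply (regular_limit f a _ (Cmod (f z)) Hf ltac:(lra)). intros e He.
      destruct (Ha e He) as [z' [[s' [Hs' [_ E']]] Hza]].
      exists z'. split; [exact Hza |]. rewrite E', scale_minus_scale.
      rewrite Rabs_pos_eq by lra. rewrite Rmult_comm.
      apply Rmult_le_compat_l; [apply Cmod_ge_0 | lra].
Qed.

(** The balls of the product structure are squares; they compare with disks up to the factor
    [sqrt 2]. *)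
Lemma locally_Cmod (P : C -> Prop) z :
  locally z P <-> exists d, 0 < d /\ forall y, Cmod (y - z) < d -> P y.
Proof.
  split.
  - intros [d Hd]. exists d. split; [apply cond_pos |]. intros y Hy.
    apply Hd, C_NormedModule_mixin_compat1, Hy.
  - intros [d [Hd H]].
    assert (Hs : 0 < d / sqrt 2) by (apply Rdiv_lt_0_compat; [exact Hd | apply Rlt_sqrt2_0]).
    exists (mkposreal _ Hs). intros y Hy. apply H.
    apply C_NormedModule_mixin_compat2 in Hy. simpl in Hy.
    replace d with (sqrt 2 * (d / sqrt 2)); [exact Hy |].
    field. apply Rgt_not_eq, Rlt_sqrt2_0.
Qed.

(** Local surjectivity supplies a preimage near [z], and the expansion bound keeps it in the
    disk. *)
Lemma open_image f r : regular f -> r <= 1 -> open (image f (disk r)).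
Proof.
  intros Hf Hr w [z [Hz <-]]. unfold disk in Hz. apply locally_Cmod.
  destruct (local_homeo f z Hf ltac:(lra)) as [rho [c [Hrho [Hc [_ [Hlow Hsur]]]]]].
  set (d := Rmin (rho / 2) (r - Cmod z)).
  assert (Hd : 0 < d) by (apply Rmin_pos; lra).
  assert (M1 : d <= rho / 2) by apply Rmin_l. assert (M2 : d <= r - Cmod z) by apply Rmin_r.
  exists (c * d). split; [apply Rmult_lt_0_compat; assumption |]. intros y Hy.
  destruct (Hsur z y) as [z' [Hz' E]].
  { rewrite Cmod_minus_diag, Rminus_0_r.
    assert (c * d <= c * (rho / 2)) by (apply Rmult_le_compat_l; lra). lra. }
  exists z'. split; [| exact E]. unfold disk.
  assert (Hzz : Cmod (z - z) < rho) by (rewrite Cmod_minus_diag; exact Hrho).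
  pose proof (Hlow z z' Hzz Hz') as H. rewrite E in H.
  assert (Cmod (z' - z) < d) by (apply Rmult_lt_reg_l with c; lra).
  pose proof (Cmod_le_minus z' z). lra.
Qed.

Lemma open_segment (U : C -> Prop) w s : open U -> U (RtoC s * w)%C ->
  exists d, 0 < d /\ forall s', Rabs (s' - s) < d -> U (RtoC s' * w)%C.
Proof.
  intros HU Hs. apply HU, locally_Cmod in Hs. destruct Hs as [d [Hd H]].
  pose proof (Cmod_ge_0 w).
  exists (d / (Cmod w + 1)). split; [apply Rdiv_lt_0_compat; lra |].
  intros s' Hs'. apply H.
  replace (RtoC s' * w - RtoC s * w)%C with (RtoC (s' - s) * w)%C
    by (rewrite RtoC_minus; ring).
  rewrite Cmod_mult, Cmod_R.
  apply Rle_lt_trans with (Rabs (s' - s) * (Cmod w + 1)).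
  - apply Rmult_le_compat_l; [apply Rabs_pos | lra].
  - replace d with (d / (Cmod w + 1) * (Cmod w + 1)) by (field; lra).
    apply Rmult_lt_compat_r; lra.
Qed.

(** If [U] and [V] never met on the segment, membership in [U] would propagate from the origin up to
    [w]: openness of [U] gives the step, openness of [V] the closure. *)
Lemma segment_meets_both (U V : C -> Prop) w : open U -> open V ->
  (forall s, 0 <= s <= 1 -> U (RtoC s * w)%C \/ V (RtoC s * w)%C) ->
  U 0%C -> V w -> exists s, 0 <= s <= 1 /\ U (RtoC s * w)%C /\ V (RtoC s * w)%C.
Proof.
  intros HU HV Hcov H0 Hw. apply NNPP; intros Hn.
  assert (H1 : 0 <= 1 /\ U (RtoC 1 * w)%C).
  { apply (real_induction 1 (fun s => 0 <= s /\ U (RtoC s * w)%C)); [lra | | |].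
    - split; [lra |]. rewrite Cmult_0_l. exact H0.
    - intros s Hs [_ HUs]. destruct (open_segment U w s HU HUs) as [d [Hd H]].
      set (e := Rmin (d / 2) (1 - s)).
      assert (He : 0 < e) by (apply Rmin_pos; lra).
      assert (M1 : e <= d / 2) by apply Rmin_l. assert (M2 : e <= 1 - s) by apply Rmin_r.
      exists (s + e). repeat split; [lra | lra | lra |].
      apply H. rewrite Rabs_pos_eq; lra.
    - intros s Hs Hlim. split; [lra |].
      destruct (Hcov s ltac:(lra)) as [HUs | HVs]; [exact HUs | exfalso].
      destruct (open_segment V w s HV HVs) as [d [Hd H]].
      destruct (Hlim d Hd) as [s' [Hs' [_ [Hs0 HUs]]]].
      apply Hn. exists s'. repeat split; [lra | lra | exact HUs |].
      apply H. apply Rabs_def1; lra. }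
  apply Hn. exists 1. repeat split; [lra | lra | apply H1 |].
  rewrite Cmult_1_l. exact Hw.
Qed.

Lemma starlike_connected (A : C -> Prop) : starlike_wrt_origin A -> connected A.
Proof.
  intros [HA0 HA] U V HU HV Hcov [a [Ha HUa]] [b [Hb HVb]].
  assert (Hcase : forall (U' V' : C -> Prop) c, open U' -> open V' ->
    (forall z, A z -> U' z \/ V' z) -> U' 0%C -> A c -> V' c ->
    exists z, A z /\ U' z /\ V' z).
  { intros U' V' c HU' HV' Hcov' H0 Hc HVc.
    destruct (segment_meets_both U' V' c HU' HV') as [s [Hs [H1 H2]]];
      [| exact H0 | exact HVc |].
    - intros s Hs. apply Hcov', HA; assumption.
    - exists (RtoC s * c)%C. repeat split; [apply HA | ..]; assumption. }
  destruct (Hcov 0%C HA0) as [H0 | H0].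
  - exact (Hcase U V b HU HV Hcov H0 Hb HVb).
  - destruct (Hcase V U a HV HU) as [z [H1 [H2 H3]]]; try assumption.
    + intros z Hz. destruct (Hcov z Hz); [right | left]; assumption.
    + exists z. repeat split; assumption.
Qed.

Lemma rotation_nonneg_fully_starlike f : regular f -> f 0%C = 0%C ->
  (forall z, Cmod z < 1 -> 0 <= rotation f z) -> fully_starlike f.
Proof.
  intros Hf Hf0 HQ. split; [exact Hf0 |]. intros r Hr.
  assert (Hs : starlike_wrt_origin (image f (disk r))).
  { split.
    - exists 0%C. split; [unfold disk; rewrite Cmod_0; lra | exact Hf0].
    - intros w t [z [Hz <-]] Ht. unfold disk in Hz.
      destruct (rotation_nonneg_lift f Hf Hf0 HQ z t ltac:(lra) Ht) as [z' [Hz' E]].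
      exists z'. split; [unfold disk; lra | exact E]. }
  split; [| exact Hs].
  repeat split.
  - exists 0%C. apply Hs.
  - apply open_image; [exact Hf | lra].
  - apply starlike_connected, Hs.
Qed.

(** * Strict differentiability of continuously differentiable maps *)

Lemma mean_value (f : R -> R) (e m a b : R) : 0 < e ->
  (forall x, Rabs (x - m) < e -> ex_derive f x) ->
  Rabs (a - m) < e -> Rabs (b - m) < e ->
  exists c, Rabs (c - m) < e /\ f b - f a = Derive f c * (b - a).
Proof.
  intros He Hd Ha Hb.
  apply Rabs_def2 in Ha. apply Rabs_def2 in Hb.
  assert (Hin : forall x, Rmin a b <= x <= Rmax a b -> Rabs (x - m) < e).
  { intros x Hx. unfold Rmin, Rmax in Hx. destruct (Rle_dec a b); apply Rabs_def1; lra. }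
  destruct (MVT_gen f a b (Derive f)) as [c [Hc E]].
  - intros x Hx. apply Derive_correct, Hd, Hin. lra.
  - intros x Hx. apply derivable_continuous_pt, ex_derive_Reals_0, Hd, Hin, Hx.
  - exists c. split; [apply Hin, Hc | exact E].
Qed.

(** The increment is split at the corner [(x, y')] and the mean value theorem is applied to each
    leg; the partial derivatives at the intermediate points are close to those at [(x0, y0)] by
    continuity. *)
Lemma strict_differentiability_2d (f : R -> R -> R) (x0 y0 d0 : R) : 0 < d0 ->
  (forall x y, Rabs (x - x0) < d0 -> Rabs (y - y0) < d0 -> ex_diff_n f 1 x y) ->
  forall e, 0 < e -> exists d, 0 < d /\ forall x y x' y',
    Rabs (x - x0) < d -> Rabs (y - y0) < d -> Rabs (x' - x0) < d -> Rabs (y' - y0) < d ->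
    Rabs (f x' y' - f x y - (Derive (fun t => f t y0) x0 * (x' - x) +
                             Derive (fun t => f x0 t) y0 * (y' - y)))
    <= e * (Rabs (x' - x) + Rabs (y' - y)).
Proof.
  intros Hd0 Hf e He.
  assert (H00 : forall t, Rabs (t - t) < d0)
    by (intros t; rewrite Rminus_diag, Rabs_R0; exact Hd0).
  destruct (Hf x0 y0 (H00 _) (H00 _)) as [_ [_ [_ [[Cx _] [Cy _]]]]].
  destruct (Cx (mkposreal e He)) as [d1 H1]. destruct (Cy (mkposreal e He)) as [d2 H2].
  simpl in H1, H2.
  pose proof (cond_pos d1). pose proof (cond_pos d2).
  set (d := Rmin d0 (Rmin d1 d2)).
  assert (Hd : 0 < d) by (repeat apply Rmin_pos; lra).
  assert (M0 : d <= d0) by apply Rmin_l.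
  assert (M1 : d <= d1) by (eapply Rle_trans; [apply Rmin_r | apply Rmin_l]).
  assert (M2 : d <= d2) by (eapply Rle_trans; [apply Rmin_r | apply Rmin_r]).
  exists d. split; [exact Hd |]. intros x y x' y' Hx Hy Hx' Hy'.
  destruct (mean_value (fun t => f t y') d x0 x x' Hd) as [c [Hc Ec]]; try assumption.
  { intros t Ht. apply (Hf t y'); lra. }
  destruct (mean_value (fun t => f x t) d y0 y y' Hd) as [k [Hk Ek]]; try assumption.
  { intros t Ht. apply (Hf x t); lra. }
  simpl in Ec, Ek.
  set (A := Derive (fun t => f t y0) x0) in *. set (B := Derive (fun t => f x0 t) y0) in *.
  assert (G1 : Rabs (Derive (fun t => f t y') c - A) < e) by (apply (H1 c y'); lra).
  assert (G2 : Rabs (Derive (fun t => f x t) k - B) < e) by (apply (H2 x k); lra).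
  replace (f x' y' - f x y - (A * (x' - x) + B * (y' - y)))
    with ((Derive (fun t => f t y') c - A) * (x' - x) +
          (Derive (fun t => f x t) k - B) * (y' - y)).
  - eapply Rle_trans; [apply Rabs_triang |]. rewrite !Rabs_mult, Rmult_plus_distr_l.
    apply Rplus_le_compat; apply Rmult_le_compat_r; try apply Rabs_pos; lra.
  - replace (f x' y' - f x y) with ((f x' y' - f x y') + (f x y' - f x y)) by ring.
    rewrite Ec, Ek. ring.
Qed.

Lemma re_minus_bound (u v : C) e : Cmod (u - v) < e -> Rabs (Re u - Re v) < e.
Proof.
  intros H. pose proof (re_le_Cmod (u - v)).
  unfold Re in *. simpl in *. unfold Rminus. lra.
Qed.

Lemma im_minus_bound (u v : C) e : Cmod (u - v) < e -> Rabs (Im u - Im v) < e.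
Proof.
  intros H. pose proof (im_le_Cmod (u - v)).
  unfold Im in *. simpl in *. unfold Rminus. lra.
Qed.

Lemma strictly_differentiable_C1 f z : Cmod z < 1 ->
  C_n_on_disk 1 f -> strictly_differentiable f z.
Proof.
  intros Hz Hf e He.
  (* The square of half-side [d0] about [z] lies in the unit disk, since the two coordinate
     deviations add up to less than [1 - Cmod z]. *)
  set (d0 := (1 - Cmod z) / 2). assert (Hd0 : 0 < d0) by (unfold d0; lra).
  assert (Hin : forall x y, Rabs (x - Re z) < d0 -> Rabs (y - Im z) < d0 -> disk 1 (x, y)).
  { intros x y Hx Hy. unfold disk.
    pose proof (Cmod_le_minus (x, y) z).
    pose proof (Cmod_le_Re_Im ((x, y) - z)) as H1.
    unfold Re, Im in *. simpl in *. unfold Rminus, d0 in *. lra. }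
  (* Each component contributes [e / 4] times a sum of two coordinate increments, hence at most
     [e / 2] times [Cmod (v - u)]. *)
  destruct (strict_differentiability_2d (fun x y => Re (f (x, y))) (Re z) (Im z) d0 Hd0)
    with (e := e / 4) as [d1 [Hd1 H1]]; [| lra |].
  { intros x y Hx Hy. apply (Hf (x, y) (Hin x y Hx Hy)). }
  destruct (strict_differentiability_2d (fun x y => Im (f (x, y))) (Re z) (Im z) d0 Hd0)
    with (e := e / 4) as [d2 [Hd2 H2]]; [| lra |].
  { intros x y Hx Hy. apply (Hf (x, y) (Hin x y Hx Hy)). }
  exists (Rmin d1 d2). split; [apply Rmin_pos; assumption |].
  intros u v Hu Hv. assert (M1 := Rmin_l d1 d2). assert (M2 := Rmin_r d1 d2).
  pose proof (re_minus_bound _ _ _ Hu). pose proof (im_minus_bound _ _ _ Hu).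
  pose proof (re_minus_bound _ _ _ Hv). pose proof (im_minus_bound _ _ _ Hv).
  specialize (H1 (Re u) (Im u) (Re v) (Im v)). specialize (H2 (Re u) (Im u) (Re v) (Im v)).
  assert (G1 := H1 ltac:(lra) ltac:(lra) ltac:(lra) ltac:(lra)).
  assert (G2 := H2 ltac:(lra) ltac:(lra) ltac:(lra) ltac:(lra)).
  replace (Re u, Im u) with u in * by (destruct u; reflexivity).
  replace (Re v, Im v) with v in * by (destruct v; reflexivity).
  eapply Rle_trans; [apply Cmod_le_Re_Im |].
  assert (E1 : Re (f v - f u - linear_map (partial_x f z) (partial_y f z) (v - u)) =
    Re (f v) - Re (f u) - (Derive (fun t => Re (f (t, Im z))) (Re z) * (Re v - Re u) +
       Derive (fun t => Re (f (Re z, t))) (Im z) * (Im v - Im u))).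
  { unfold linear_map, partial_x, partial_y, Re, Im. simpl. ring. }
  assert (E2 : Im (f v - f u - linear_map (partial_x f z) (partial_y f z) (v - u)) =
    Im (f v) - Im (f u) - (Derive (fun t => Im (f (t, Im z))) (Re z) * (Re v - Re u) +
       Derive (fun t => Im (f (Re z, t))) (Im z) * (Im v - Im u))).
  { unfold linear_map, partial_x, partial_y, Re, Im. simpl. ring. }
  rewrite E1, E2.
  pose proof (re_le_Cmod (v - u)) as R1. pose proof (im_le_Cmod (v - u)) as R2.
  replace (Re (v - u)) with (Re v - Re u) in R1 by (unfold Re; simpl; ring).
  replace (Im (v - u)) with (Im v - Im u) in R2 by (unfold Im; simpl; ring).
  nra.
Qed.

Lemma jacobian_cross f z : jacobian f z = cross (partial_x f z) (partial_y f z).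
Proof.
  unfold jacobian, d_z, d_zbar. rewrite !Cmod2_alt.
  destruct (partial_x f z) as [a b], (partial_y f z) as [c d].
  unfold cross, Re, Im. simpl. field.
Qed.

Lemma p_harmonic_regular p f : (1 <= p)%nat -> p_harmonic p f ->
  (forall z, disk 1 z -> 0 < jacobian f z) -> regular f.
Proof.
  intros Hp [Hf _] HJ z Hz. split.
  - apply strictly_differentiable_C1; [exact Hz |]. intros w Hw.
    split; apply (ex_diff_n_m (2 * p)); try lia; apply Hf, Hw.
  - rewrite <- jacobian_cross. apply HJ, Hz.
Qed.

(** * Velocities of curves and the rotation of a polyharmonic function *)

(** The derivative at [0] of a plane curve, stated as a first-order estimate so that it combines
    directly with real differentials, complex derivatives and conjugation. *)
Definition has_velocity (phi : R -> C) (v : C) : Prop :=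
  forall e, 0 < e -> exists d, 0 < d /\
    forall t, Rabs t < d -> Cmod (phi t - phi 0 - RtoC t * v) <= e * Rabs t.

Lemma has_velocity_unique phi v w : has_velocity phi v -> has_velocity phi w -> v = w.
Proof.
  intros Hv Hw. apply Cmod_minus_eq_0, le_epsilon. intros e He.
  destruct (Hv (e / 2)) as [d1 [Hd1 H1]]; [lra |].
  destruct (Hw (e / 2)) as [d2 [Hd2 H2]]; [lra |].
  set (t := Rmin d1 d2 / 2).
  assert (0 < Rmin d1 d2) by (apply Rmin_pos; assumption).
  assert (M1 := Rmin_l d1 d2). assert (M2 := Rmin_r d1 d2).
  assert (Ht : Rabs t = t) by (apply Rabs_pos_eq; unfold t; lra).
  specialize (H1 t ltac:(rewrite Ht; unfold t; lra)).
  specialize (H2 t ltac:(rewrite Ht; unfold t; lra)).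
  rewrite Ht in H1, H2.
  assert (H3 : t * Cmod (v - w) <= e * t).
  { rewrite <- Ht at 1. rewrite <- Cmod_R, <- Cmod_mult.
    replace (RtoC t * (v - w))%C with
      ((phi t - phi 0 - RtoC t * w) + - (phi t - phi 0 - RtoC t * v))%C by ring.
    eapply Rle_trans; [apply Cmod_triangle |]. rewrite Cmod_opp. lra. }
  assert (0 < t) by (unfold t; lra).
  apply Rmult_le_reg_l with t; lra.
Qed.

Lemma has_velocity_plus phi psi v w : has_velocity phi v -> has_velocity psi w ->
  has_velocity (fun t => phi t + psi t)%C (v + w)%C.
Proof.
  intros Hv Hw e He.
  destruct (Hv (e / 2)) as [d1 [Hd1 H1]]; [lra |].
  destruct (Hw (e / 2)) as [d2 [Hd2 H2]]; [lra |].
  exists (Rmin d1 d2). split; [apply Rmin_pos; assumption |]. intros t Ht.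
  assert (M1 := Rmin_l d1 d2). assert (M2 := Rmin_r d1 d2).
  specialize (H1 t ltac:(lra)). specialize (H2 t ltac:(lra)).
  replace (phi t + psi t - (phi 0 + psi 0) - RtoC t * (v + w))%C with
    ((phi t - phi 0 - RtoC t * v) + (psi t - psi 0 - RtoC t * w))%C by ring.
  eapply Rle_trans; [apply Cmod_triangle | lra].
Qed.

Lemma has_velocity_scal c phi v : has_velocity phi v ->
  has_velocity (fun t => c * phi t)%C (c * v)%C.
Proof.
  intros Hv e He. pose proof (Cmod_ge_0 c).
  destruct (Hv (e / (Cmod c + 1))) as [d [Hd H1]]; [apply Rdiv_lt_0_compat; lra |].
  exists d. split; [exact Hd |]. intros t Ht. specialize (H1 t Ht).
  replace (c * phi t - c * phi 0 - RtoC t * (c * v))%C with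
    (c * (phi t - phi 0 - RtoC t * v))%C by ring.
  rewrite Cmod_mult.
  apply Rle_trans with ((Cmod c + 1) * (e / (Cmod c + 1) * Rabs t)).
  - pose proof (Cmod_ge_0 (phi t - phi 0 - RtoC t * v)). apply Rmult_le_compat; lra.
  - apply Req_le. field. lra.
Qed.

Lemma has_velocity_conj phi v : has_velocity phi v ->
  has_velocity (fun t => Cconj (phi t)) (Cconj v).
Proof.
  intros Hv e He. destruct (Hv e He) as [d [Hd H]]. exists d. split; [exact Hd |].
  intros t Ht. rewrite <- Cmod_conj.
  replace (Cconj (Cconj (phi t) - Cconj (phi 0) - RtoC t * Cconj v))
    with (phi t - phi 0 - RtoC t * v)%C; [exact (H t Ht) |].
  rewrite !Cminus_conj, Cmult_conj, !Cconj_conj.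
  f_equal. f_equal. apply injective_projections; simpl; ring.
Qed.

Lemma has_velocity_sum phi v m :
  (forall k, (1 <= k <= m)%nat -> has_velocity (phi k) (v k)) ->
  has_velocity (fun t => sum_n_m (fun k => phi k t) 1 m) (sum_n_m v 1 m).
Proof.
  induction m as [| m IH]; intros H e He.
  - exists 1. split; [lra |]. intros t Ht. rewrite !sum_n_m_zero by lia.
    replace (Cmod _) with 0; [apply Rmult_le_pos; [lra | apply Rabs_pos] |].
    symmetry. rewrite <- Cmod_0. f_equal. apply injective_projections; simpl; ring.
  - destruct (has_velocity_plus (fun t => sum_n_m (fun k => phi k t) 1 m) (phi (S m))
      (sum_n_m v 1 m) (v (S m))) with (e := e) as [d [Hd Hd']]; [| | exact He |].
    + apply IH. intros k Hk. apply H. lia.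
    + apply H. lia.
    + exists d. split; [exact Hd |]. intros t Ht.
      rewrite !sum_n_Sm by lia. exact (Hd' t Ht).
Qed.

(** Only differentiability at the point [z] is assumed, with an arbitrary real differential, so that
    the rule covers both [Phi] and the analytic components. *)
Lemma has_velocity_chain f z a b phi v :
  (forall e, 0 < e -> exists rho, 0 < rho /\ forall u, Cmod (u - z) < rho ->
     Cmod (f u - f z - linear_map a b (u - z)) <= e * Cmod (u - z)) ->
  has_velocity phi v -> phi 0 = z ->
  has_velocity (fun t => f (phi t)) (linear_map a b v).
Proof.
  intros Hf Hv H0 e He.
  pose proof (Cmod_ge_0 v) as Nv. pose proof (Cmod_ge_0 a) as Na. pose proof (Cmod_ge_0 b) as Nb.
  set (K := Cmod v + 1). set (N := Cmod a + Cmod b + 1).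
  assert (HK : 0 < K) by (unfold K; lra). assert (HN : 0 < N) by (unfold N; lra).
  destruct (Hf (e / (2 * K))) as [rho [Hrho H1]]; [apply Rdiv_lt_0_compat; lra |].
  destruct (Hv (Rmin 1 (e / (2 * N)))) as [d [Hd H2]].
  { apply Rmin_pos; [lra | apply Rdiv_lt_0_compat; lra]. }
  assert (M1 := Rmin_l 1 (e / (2 * N))). assert (M2 := Rmin_r 1 (e / (2 * N))).
  exists (Rmin d (rho / K)).
  split; [apply Rmin_pos; [| apply Rdiv_lt_0_compat]; assumption |].
  intros t Ht.
  assert (M3 := Rmin_l d (rho / K)). assert (M4 := Rmin_r d (rho / K)).
  specialize (H2 t ltac:(lra)). rewrite H0 in *.
  pose proof (Rabs_pos t).
  assert (Hphi : Cmod (phi t - z) <= K * Rabs t).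
  { pose proof (Cmod_le_minus (phi t - z) (RtoC t * v)) as Hl.
    rewrite Cmod_mult, Cmod_R in Hl. unfold K. nra. }
  assert (HtK : K * Rabs t < rho).
  { replace rho with (K * (rho / K)) by (field; lra). apply Rmult_lt_compat_l; lra. }
  specialize (H1 (phi t) ltac:(lra)).
  replace (f (phi t) - f z - RtoC t * linear_map a b v)%C with
    ((f (phi t) - f z - linear_map a b (phi t - z)) +
     linear_map a b (phi t - z - RtoC t * v))%C
    by (rewrite (linear_map_minus a b (phi t - z)), linear_map_scal; ring).
  eapply Rle_trans; [apply Cmod_triangle |].
  pose proof (linear_map_bound a b (phi t - z - RtoC t * v)) as H3.
  assert (H4 : e / (2 * K) * Cmod (phi t - z) <= e / 2 * Rabs t).
  { replace (e / 2 * Rabs t) with (e / (2 * K) * (K * Rabs t)) by (field; lra).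
    apply Rmult_le_compat_l; [| exact Hphi].
    left. apply Rdiv_lt_0_compat; lra. }
  assert (H5 : (Cmod a + Cmod b) * Cmod (phi t - z - RtoC t * v) <= e / 2 * Rabs t).
  { replace (e / 2 * Rabs t) with (N * (e / (2 * N) * Rabs t)) by (field; lra).
    apply Rmult_le_compat; [lra | apply Cmod_ge_0 | unfold N; lra |].
    eapply Rle_trans; [exact H2 |]. apply Rmult_le_compat_r; lra. }
  lra.
Qed.

(** The Cauchy-Riemann form of a differential: the columns [c] and [Ci * c] represent multiplication
    by [c]. *)
Lemma linear_map_Cmult c xi : linear_map c (Ci * c) xi = (c * xi)%C.
Proof. apply injective_projections; unfold linear_map, Re, Im; simpl; ring. Qed.

Lemma has_velocity_analytic h z phi v : analytic h -> disk 1 z ->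
  has_velocity phi v -> phi 0 = z ->
  has_velocity (fun t => h (phi t)) (C_derive h z * v)%C.
Proof.
  intros Hh Hz Hv H0. rewrite <- linear_map_Cmult.
  apply (has_velocity_chain h z); [| exact Hv | exact H0].
  intros e He.
  destruct (C_derive_correct h z z (Hh z Hz)) as [_ Hd].
  destruct (Hd z (fun P H => H) (mkposreal e He)) as [d H].
  exists d. split; [apply cond_pos |]. intros u Hu.
  rewrite linear_map_Cmult, Cmult_comm. exact (H u Hu).
Qed.

(** The curve [z * e^(i t)]. *)
Definition circle (z : C) (t : R) : C := (z * (cos t, sin t))%C.

Lemma circle_0 z : circle z 0 = z.
Proof.
  unfold circle. rewrite cos_0, sin_0. apply injective_projections; simpl; ring.
Qed.

Lemma Cmod_circle z t : Cmod (circle z t) = Cmod z.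
Proof.
  unfold circle. rewrite Cmod_mult.
  replace (Cmod (cos t, sin t)) with 1; [ring |].
  unfold Cmod. simpl.
  replace (cos t * (cos t * 1) + sin t * (sin t * 1)) with 1.
  - symmetry. apply sqrt_1.
  - pose proof (sin2_cos2 t) as H. unfold Rsqr in H. lra.
Qed.

Lemma derivable_pt_lim_bound f l : derivable_pt_lim f 0 l ->
  forall e, 0 < e -> exists d, 0 < d /\
    forall t, Rabs t < d -> Rabs (f t - f 0 - t * l) <= e * Rabs t.
Proof.
  intros Hf e He. destruct (Hf e He) as [d Hd]. exists d. split; [apply cond_pos |].
  intros t Ht. destruct (Req_dec t 0) as [-> | Ht0].
  - replace (f 0 - f 0 - 0 * l) with 0 by ring. rewrite Rabs_R0. lra.
  - specialize (Hd t Ht0 Ht). rewrite Rplus_0_l in Hd.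
    replace (f t - f 0 - t * l) with (((f t - f 0) / t - l) * t) by (field; exact Ht0).
    rewrite Rabs_mult. apply Rmult_le_compat_r; [apply Rabs_pos | lra].
Qed.

Lemma has_velocity_circle z : has_velocity (circle z) (Ci * z)%C.
Proof.
  rewrite Cmult_comm. apply (has_velocity_scal z (fun t => (cos t, sin t)) Ci).
  intros e He.
  destruct (derivable_pt_lim_bound cos 0 derivable_pt_lim_cos_0 (e / 2)) as [d1 [Hd1 H1]];
    [lra |].
  destruct (derivable_pt_lim_bound sin 1 derivable_pt_lim_sin_0 (e / 2)) as [d2 [Hd2 H2]];
    [lra |].
  exists (Rmin d1 d2). split; [apply Rmin_pos; assumption |]. intros t Ht.
  assert (M1 := Rmin_l d1 d2). assert (M2 := Rmin_r d1 d2).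
  specialize (H1 t ltac:(lra)). specialize (H2 t ltac:(lra)).
  eapply Rle_trans; [apply Cmod_le_Re_Im |].
  set (w := ((cos t, sin t) - (cos 0, sin 0) - RtoC t * Ci)%C).
  replace (Re w) with (cos t - cos 0 - t * 0) by (unfold w, Re; simpl; ring).
  replace (Im w) with (sin t - sin 0 - t * 1) by (unfold w, Im; simpl; ring).
  lra.
Qed.

Lemma cross_sum w u m :
  cross w (sum_n_m u 1 m) = sum_n_m (fun k => cross w (u k)) 1 m.
Proof.
  induction m as [| m IH].
  - rewrite !sum_n_m_zero by lia. unfold cross, Re, Im. simpl. unfold zero. simpl. ring.
  - rewrite !sum_n_Sm by lia. rewrite <- IH. unfold cross, Re, Im. simpl.
    unfold plus. simpl. ring.
Qed.

(* On the circle [|zeta| = |z|] the weights [|zeta|^(2(k-1))] are constant, so only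
   the harmonic components contribute to the angular derivative. *)
Lemma rotation_polyharmonic p (Phi : C -> C) (F h g : nat -> C -> C) z :
  regular Phi -> disk 1 z ->
  (forall z : C, disk 1 z ->
     Phi z = sum_n_m (fun k : nat =>
       (RtoC (Cmod z ^ (2 * (k - 1))) * F (p - k + 1)%nat z)%C) 1 p) ->
  (forall k : nat, (1 <= k <= p)%nat -> analytic (h (p - k + 1)%nat)) ->
  (forall k : nat, (1 <= k <= p)%nat -> analytic (g (p - k + 1)%nat)) ->
  (forall (k : nat) (z : C), (1 <= k <= p)%nat -> disk 1 z ->
     F (p - k + 1)%nat z = (h (p - k + 1)%nat z + Cconj (g (p - k + 1)%nat z))%C) ->
  sum_n_m (fun k : nat =>
    Cmod z ^ (2 * (k - 1)) *
    Re (z * C_derive (h (p - k + 1)%nat) z * Cconj (Phi z))%C) 1 p =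
  rotation Phi z +
  sum_n_m (fun k : nat =>
    Cmod z ^ (2 * (k - 1)) *
    Re (z * C_derive (g (p - k + 1)%nat) z * Phi z)%C) 1 p.
Proof.
  intros HPhi Hz Hrep Hh Hg HF.
  pose proof (has_velocity_circle z) as Hc. pose proof (circle_0 z) as Hc0.
  (* The velocity of [Phi] along the circle is computed twice, here from the partial derivatives and
     in [V2] from the representation; comparing the two gives the identity. *)
  assert (V1 : has_velocity (fun t => Phi (circle z t))
            (linear_map (partial_x Phi z) (partial_y Phi z) (Ci * z))).
  { apply (has_velocity_chain Phi z); [| exact Hc | exact Hc0].
    intros e He. destruct (proj1 (HPhi z Hz) e He) as [rho [Hrho H]].
    exists rho. split; [exact Hrho |]. intros u Hu. apply H; [| exact Hu].
    rewrite Cmod_minus_diag. exact Hrho. }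
  set (v := fun k : nat => (RtoC (Cmod z ^ (2 * (k - 1))) *
    (C_derive (h (p - k + 1)%nat) z * (Ci * z) +
     Cconj (C_derive (g (p - k + 1)%nat) z * (Ci * z))))%C).
  assert (V2 : has_velocity (fun t => sum_n_m (fun k => (RtoC (Cmod z ^ (2 * (k - 1))) *
      (h (p - k + 1)%nat (circle z t) + Cconj (g (p - k + 1)%nat (circle z t))))%C) 1 p)
      (sum_n_m v 1 p)).
  { apply (has_velocity_sum (fun k t => (RtoC (Cmod z ^ (2 * (k - 1))) *
      (h (p - k + 1)%nat (circle z t) + Cconj (g (p - k + 1)%nat (circle z t))))%C)).
    intros k Hk. apply has_velocity_scal.
    apply (has_velocity_plus (fun t => h (p - k + 1)%nat (circle z t))
             (fun t => Cconj (g (p - k + 1)%nat (circle z t)))).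
    - apply has_velocity_analytic; auto.
    - apply (has_velocity_conj (fun t => g (p - k + 1)%nat (circle z t))).
      apply has_velocity_analytic; auto. }
  assert (Hext : forall t, Phi (circle z t) = sum_n_m (fun k =>
      (RtoC (Cmod z ^ (2 * (k - 1))) *
      (h (p - k + 1)%nat (circle z t) + Cconj (g (p - k + 1)%nat (circle z t))))%C) 1 p).
  { intros t. assert (Hd : disk 1 (circle z t)) by (unfold disk; rewrite Cmod_circle; exact Hz).
    rewrite (Hrep _ Hd). apply sum_n_m_ext_loc. intros k Hk.
    rewrite Cmod_circle, (HF k _ Hk Hd). reflexivity. }
  assert (V2' : has_velocity (fun t => Phi (circle z t)) (sum_n_m v 1 p)).
  { intros e He. destruct (V2 e He) as [d [Hd H]]. exists d. split; [exact Hd |].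
    intros t Ht. rewrite !Hext. exact (H t Ht). }
  (* For [w = Phi z], [cross w] of [h' * (Ci * z)] is [Re (z * h' * Cconj w)], and [cross w] of the
     conjugate of [g' * (Ci * z)] is [- Re (z * g' * w)]. *)
  unfold rotation. rewrite (has_velocity_unique _ _ _ V1 V2'), cross_sum.
  symmetry. rewrite <- (sum_n_m_plus (G := R_AbelianMonoid)).
  apply sum_n_m_ext. intros k. unfold v, cross, plus. simpl. unfold Re, Im. simpl. ring.
Qed.

(** * The starlikeness criterion for p-harmonic functions *)

Open Scope C_scope.

Theorem corollary1 (p : nat) (p_ge1 : (1 <= p)%nat)
  (Phi : C -> C) (F h g : nat -> C -> C)
  (Phi_pharm : p_harmonic p Phi)
  (Phi_rep : forall z : C, disk 1 z ->
     Phi z = sum_n_m (fun k : nat =>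
       RtoC (Cmod z ^ (2 * (k - 1))) * F (p - k + 1)%nat z) 1 p)
  (Phi_0 : Phi 0 = 0)
  (F_harm : forall k : nat, (1 <= k <= p)%nat -> harmonic (F (p - k + 1)%nat))
  (h_an : forall k : nat, (1 <= k <= p)%nat -> analytic (h (p - k + 1)%nat))
  (g_an : forall k : nat, (1 <= k <= p)%nat -> analytic (g (p - k + 1)%nat))
  (F_rep : forall (k : nat) (z : C), (1 <= k <= p)%nat -> disk 1 z ->
     F (p - k + 1)%nat z = h (p - k + 1)%nat z + Cconj (g (p - k + 1)%nat z))
  (J_pos : forall z : C, disk 1 z -> (0 < jacobian Phi z)%R) :
  fully_starlike Phi <->
  (forall z : C, disk 1 z ->
     (sum_n_m (fun k : nat =>
        Cmod z ^ (2 * (k - 1)) *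
        Re (z * C_derive (h (p - k + 1)%nat) z * Cconj (Phi z))%C) 1 p
      >=
      sum_n_m (fun k : nat =>
        Cmod z ^ (2 * (k - 1)) *
        Re (z * C_derive (g (p - k + 1)%nat) z * Phi z)%C) 1 p)%R).
Proof.
  pose proof (p_harmonic_regular p Phi p_ge1 Phi_pharm J_pos) as Hreg.
  (* The two sums differ by [rotation Phi z], so the inequality at [z] says exactly that the
     rotation is nonnegative there. *)
  assert (Hrot : forall z, disk 1 z -> _) by
    (intros z Hz; exact (rotation_polyharmonic p Phi F h g z Hreg Hz Phi_rep h_an g_an F_rep)).
  split.
  - intros [_ Hs] z Hz. rewrite (Hrot z Hz).
    assert (0 <= rotation Phi z)%R; [| lra].
    apply starlike_rotation_nonneg; [exact Hreg | exact Phi_0 | | exact Hz].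
    intros r Hr. apply Hs, Hr.
  - intros H. apply rotation_nonneg_fully_starlike; [exact Hreg | exact Phi_0 |].
    intros z Hz. specialize (H z Hz). rewrite (Hrot z Hz) in H. lra.
Qed.
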